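(* Suppose that $(X,\mathcal{E})$ and $(Y,\mathcal{F})$ are metrizable uniformly locally finite coarse spaces and that there exists an isomorphism $\Phi\colon \mathrm{C}^*_u(X)\to \mathrm{C}^*_u(Y)$ which is not rigidly implemented. Then at least one of the following applies. (i) $\Phi[\ell_\infty(X)]$ is a ghostly Cartan masa in $\mathrm{C}^*_u(Y)$. (ii) $\Phi^{-1}[\ell_\infty(Y)]$ is a ghostly Cartan masa in $\mathrm{C}^*_u(X)$.
   Context: Coarse structures. A coarse structure on a set $X$ is a collection $\mathcal{E}$ of subsets of $X\times X$ (called entourages) which contains the diagonal $\Delta_X=\{(x,x): x\in X\}$ and is closed under taking subsets, inverses $E^{-1}=\{(x,y):(y,x)\in E\}$, finite unions, and compositions $E\circ F=\{(x,y): \exists z\ (x,z)\in E,\ (z,y)\in F\}$; $(X,\mathcal{E})$ is a coarse space. $(X,\mathcal{E})$ is metrizable if for some metric $d$ on $X$, $\mathcal{E}$ is the smallest coarse structure containing all $E_r=\{(x,y): d(x,y)\le r\}$, $r\ge 0$. It is uniformly locally finite if $\sup_{x\in X}|\{y\in X:(x,y)\in E\}|<\infty$ for all $E\in\mathcal{E}$. Uniform Roe algebras. For $T\in B(\ell_2(X))$ let $\mathrm{supp}(T)=\{(x,x'):\langle T\delta_x,\delta_{x'}\rangle\ne 0\}$. The uniform Roe algebra $\mathrm{C}^*_u(X)$ is the norm closure in $B(\ell_2(X))$ of $\{T\in B(\ell_2(X)): \mathrm{supp}(T)\in\mathcal{E}\}$. $\ell_\infty(X)$ is identified with the operators whose support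 is contained in $\Delta_X$, so $\ell_\infty(X)\subset \mathrm{C}^*_u(X)$. Isomorphisms of C*-algebras are $*$-isomorphisms. An isomorphism $\Phi\colon \mathrm{C}^*_u(X)\to \mathrm{C}^*_u(Y)$ is rigidly implemented (is a rigid isomorphism) if there is a unitary $U\colon\ell_2(X)\to\ell_2(Y)$ with $\Phi(T)=UTU^*$ for all $T$, $\inf_{x\in X}\sup_{y\in Y}|\langle U\delta_x,\delta_y\rangle|>0$ and $\inf_{y\in Y}\sup_{x\in X}|\langle U^*\delta_y,\delta_x\rangle|>0$. An operator $T\in \mathrm{C}^*_u(X)$ is a ghost if for all $\varepsilon>0$ there is a finite $A\subset X$ such that $|\langle T\delta_x,\delta_{x'}\rangle|<\varepsilon$ for all $x,x'\in X\setminus A$. Cartan masas. A C*-subalgebra $B$ of a C*-algebra $A$ is a Cartan masa if (1) $B$ is a maximal abelian self-adjoint subalgebra of $A$; (2) $B$ contains an approximate unit for $A$; (3) the normalizer $\{a\in A: aBa^*\cup a^*Ba\subset B\}$ generates $A$ as a C*-algebra; (4) there is a faithful conditional expectation from $A$ onto $B$. A Cartan masa $A$ in $\mathrm{C}^*_u(X)$ is ghostly if it contains non-compact ghost projections $Q_j$, $j\in J$, which are (pairwise) orthogonal and such that $\sum_{j\in J}Q_j$ converges strongly to the identity of $\mathrm{C}^*_u(X)$. *)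

(* Defs.v *)
From HB Require Import structures.
From mathcomp Require Import all_boot all_order all_algebra finmap.
From mathcomp Require Import all_classical all_reals all_analysis.
From mathcomp Require Import complex ring lra.
From mathcomp Require Import showcase.summability.

Set Implicit Arguments.
Unset Strict Implicit.
Unset Printing Implicit Defensive.

Import Order.TTheory GRing.Theory Num.Theory numFieldNormedType.Exports.
Import ComplexField.Normc.

Local Open Scope classical_set_scope.
Local Open Scope complex_scope.
Local Open Scope ring_scope.

Section square_summable.
Context {R : realType} {X : choiceType}.
Implicit Types f g : X -> R[i]^o.

Definition sqsum f : \bar R :=
  \esum_(x in [set: X]) (normc (f x : R[i]) ^+ 2)%:E.

Definition l2 : {pred X -> R[i]^o} := [pred f | (sqsum f < +oo)%E].

Lemma sqsum_ge0 f : (0 <= sqsum f)%E.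
Proof. by apply: esum_ge0 => x _; rewrite lee_fin sqr_ge0. Qed.

Lemma esumZ_le (c : R) (a : X -> \bar R) : 0 <= c ->
  (forall x, (0 <= a x)%E) ->
  (\esum_(x in [set: X]) (c%:E * a x) <= c%:E * \esum_(x in [set: X]) a x)%E.
Proof.
move=> c0 a0; apply: ge_ereal_sup => _ [F [finF _] <-].
rewrite -ge0_mule_fsumr//; apply: lee_pmul => //.
  by rewrite fsume_ge0.
by apply: ereal_sup_ubound; exists F.
Qed.

Lemma sqsumZ_le (c : R[i]) f :
  (sqsum (c *: f) <= (normc c ^+ 2)%:E * sqsum f)%E.
Proof.
apply: le_trans (esumZ_le _ _); last 2 first.
- by rewrite sqr_ge0.
- by move=> x; rewrite lee_fin sqr_ge0.
apply: le_esum => x _.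
by rewrite -EFinM lee_fin -exprMn -normcM.
Qed.

Lemma sqsumD_le (t : R) f g : 0 < t ->
  (sqsum (f + g)%R <= (1 + t)%:E * sqsum f + (1 + t^-1)%:E * sqsum g)%E.
Proof.
move=> t0.
have t1 : 0 <= t^-1 by rewrite invr_ge0 ltW.
apply: le_trans (leeD (esumZ_le _ _) (esumZ_le _ _)); last 4 first.
- by lra.
- by move=> x; rewrite lee_fin sqr_ge0.
- by lra.
- by move=> x; rewrite lee_fin sqr_ge0.
rewrite -esumD; last 2 first.
- by move=> x _; rewrite -EFinM lee_fin mulr_ge0 ?sqr_ge0//; lra.
- by move=> x _; rewrite -EFinM lee_fin mulr_ge0 ?sqr_ge0//; lra.
apply: le_esum => x _; rewrite -!EFinM -EFinD lee_fin.
have := le_normcD (f x : R[i]) (g x : R[i]).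
rewrite {1}(_ : (f + g) x = f x + g x :> R[i])//.
set a := normc (f x : R[i]); set b := normc (g x : R[i]).
set c := normc _ => cab.
have c0 : 0 <= c by rewrite /c; case: (_ + _) => u v; exact: Num.Theory.sqrtr_ge0.
have : c ^+ 2 <= (a + b) ^+ 2 by rewrite ler_sqr ?nnegrE// (le_trans c0).
move/le_trans; apply.
have -> : (1 + t) * a ^+ 2 + (1 + t^-1) * b ^+ 2 =
  (a + b) ^+ 2 + t^-1 * (t * a - b) ^+ 2 by field; rewrite gt_eqF.
by rewrite lerDl mulr_ge0 ?sqr_ge0.
Qed.

Lemma l2_submod_closed : submod_closed l2.
Proof.
split.
  rewrite inE /sqsum (esum1 _) ?ltry// => x _.
  by rewrite (_ : (0 : X -> R[i]^o) x = 0 :> R[i])// normc0 expr0n.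
move=> c f g; rewrite !inE => fl2 gl2.
have cf : (sqsum (c *: f) < +oo)%E.
  apply: le_lt_trans (sqsumZ_le _ _) _.
  by rewrite lte_mul_pinfty// lee_fin sqr_ge0.
apply: le_lt_trans (sqsumD_le _ _ ltr01) _.
by rewrite lte_add_pinfty// lte_mul_pinfty// lee_fin; lra.
Qed.

HB.instance Definition _ := GRing.isSubmodClosed.Build _ _ l2 l2_submod_closed.

End square_summable.

Record ell2 (R : realType) (X : choiceType) := Ell2 {
  ell2_fun :> X -> R[i]^o;
  _ : ell2_fun \in l2 }.

HB.instance Definition _ R X := [isSub for @ell2_fun R X].
HB.instance Definition _ R X := [Choice of ell2 R X by <:].
HB.instance Definition _ R X := [SubChoice_isSubLmodule of ell2 R X by <:].

Section ell2_norm.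
Context {R : realType} {X : choiceType}.
Implicit Types u v : ell2 R X.

Definition ell2_norm u : R := Num.sqrt (fine (sqsum u)).

Lemma sqsumE u : sqsum u = (ell2_norm u ^+ 2)%:E.
Proof.
have := valP u; rewrite inE => ufin.
rewrite sqr_sqrtr ?fine_ge0 ?sqsum_ge0// fineK// ge0_fin_numE//.
exact: sqsum_ge0.
Qed.

Lemma ell2_norm_ge0 u : 0 <= ell2_norm u.
Proof. exact: Num.Theory.sqrtr_ge0. Qed.

Lemma ell2_norm0_eq0 u : ell2_norm u = 0 -> u = 0.
Proof.
move=> u0; apply/val_inj/funext => x; apply: eq0_normc.
have := sqsumE u; rewrite u0 expr0n /= => su.
have : ((normc (u x : R[i]) ^+ 2)%:E <= sqsum u)%E.
  apply: esum_ge; exists [set x] => //; rewrite fsbig_set1//.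
rewrite su lee_fin => h; apply/eqP; rewrite -sqrf_eq0 eq_le h sqr_ge0//.
Qed.

Lemma ell2_normZ_le (c : R[i]) u : ell2_norm (c *: u) <= normc c * ell2_norm u.
Proof.
have c0 : 0 <= normc c by case: c => a b; exact: Num.Theory.sqrtr_ge0.
rewrite -ler_sqr ?nnegrE ?mulr_ge0 ?ell2_norm_ge0// exprMn.
by rewrite -lee_fin [leRHS]EFinM -!sqsumE; exact: sqsumZ_le.
Qed.

Lemma ell2_normZ (c : R[i]) u : ell2_norm (c *: u) = normc c * ell2_norm u.
Proof.
apply/eqP; rewrite eq_le ell2_normZ_le /=.
have [->|c0] := eqVneq c 0; first by rewrite normc0 mul0r ell2_norm_ge0.
have nc0 : normc c != 0 by apply: contra c0 => /eqP/eq0_normc ->.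
have nc : 0 < normc c.
  by rewrite lt_neqAle eq_sym nc0; case: (c) => a b; exact: Num.Theory.sqrtr_ge0.
rewrite -ler_pdivlMl// -normcV; apply: le_trans (ell2_normZ_le _ _).
by rewrite scalerA mulVf// scale1r.
Qed.

Lemma ler_ell2_normD u v : ell2_norm (u + v) <= ell2_norm u + ell2_norm v.
Proof.
have [/ell2_norm0_eq0 ->|u0] := eqVneq (ell2_norm u) 0.
  by rewrite add0r lerDr ell2_norm_ge0.
have [/ell2_norm0_eq0 ->|v0] := eqVneq (ell2_norm v) 0.
  by rewrite addr0 lerDl ell2_norm_ge0.
have {}u1 : 0 < ell2_norm u by rewrite lt_neqAle eq_sym u0 ell2_norm_ge0.
have {}v1 : 0 < ell2_norm v by rewrite lt_neqAle eq_sym v0 ell2_norm_ge0.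
rewrite -ler_sqr ?nnegrE ?addr_ge0 ?ell2_norm_ge0//.
rewrite -lee_fin -sqsumE.
have := @sqsumD_le _ _ (ell2_norm v / ell2_norm u) u v (divr_gt0 v1 u1).
move/le_trans; apply; rewrite !sqsumE -!EFinM -EFinD lee_fin le_eqVlt.
by apply/orP; left; apply/eqP; field; rewrite u0 v0.
Qed.

Let norm u : R[i] := (ell2_norm u)%:C.

Let ler_normD u v : norm (u + v) <= norm u + norm v.
Proof. by rewrite /norm -rmorphD lecR ler_ell2_normD. Qed.

Let normZ (c : R[i]) u : norm (c *: u) = `|c| * norm u.
Proof. by rewrite /norm ell2_normZ rmorphM. Qed.

Let norm0_eq0 u : norm u = 0 -> u = 0.
Proof. by move=> /complexI /ell2_norm0_eq0. Qed.

HB.instance Definition _ :=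
  Lmodule_isNormed.Build R[i] (ell2 R X) ler_normD normZ norm0_eq0.

End ell2_norm.

Section inner_product.
Context {R : realType} {X : choiceType}.
Implicit Types u v : ell2 R X.

Lemma delta_l2 (x : X) : (fun y => (y == x)%:R : R[i]^o) \in l2.
Proof.
rewrite inE /sqsum.
rewrite (eq_esum (b := fun y => if y \in [set x] then 1%:E else 0%E)).
  by rewrite -esum_mkcond esum_set1 ?ltry// lee_fin.
move=> y _; case: (eqVneq y x) => [->|yx].
  by rewrite mem_set// normc1 expr1n.
by rewrite memNset ?normc0 ?expr0n//= => /eqP; exact/negP.
Qed.

Definition delta (x : X) : ell2 R X := Ell2 (delta_l2 x).

(* The sum converges, by Cauchy-Schwarz; it is linear in the first argument. *)
Definition inner u v : R[i] := sum (fun x => (u x : R[i]) * (v x : R[i])^*%C : R[i]^o).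

Lemma inner_delta u (x : X) : inner u (delta x) = u x.
Proof.
apply: (@cvg_lim R[i]^o (@norm_hausdorff _ R[i]^o) _ _ totally_filter).
apply: (@cvg_near_cst _ _ _ _ _ totally_filter); exists [fset x]%fset => // A /= xA.
have {}xA : x \in A by apply: (fsubsetP xA); rewrite inE.
rewrite /partial_sum (bigD1 [` xA]%fset)//= eqxx rmorph1 mulr1 big1 ?addr0//.
move=> y yx; rewrite (_ : (val y == x) = false) ?rmorph0 ?mulr0//.
by apply: contraNF yx => /eqP yx; apply/eqP/val_inj.
Qed.

End inner_product.

Section operators.
Context {R : realType}.
Implicit Types X Y : choiceType.

Definition bounded_op {X Y} (T : ell2 R X -> ell2 R Y) : Prop :=
  linear T /\ continuous T.

Definition opnorm {X Y} (T : ell2 R X -> ell2 R Y) : R :=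
  sup [set ell2_norm (T u) | u in [set u | ell2_norm u <= 1]].

(* By the Riesz representation theorem, a bounded operator has exactly one
   adjoint; the default value 0 is only used for the other functions. *)
Definition adj {X Y} (T : ell2 R X -> ell2 R Y) : ell2 R Y -> ell2 R X :=
  xget 0 [set S | bounded_op S /\ forall u v, inner (T u) v = inner u (S v)].

Definition unitary_op {X Y} (U : ell2 R X -> ell2 R Y) : Prop :=
  [/\ bounded_op U, adj U \o U = id & U \o adj U = id].

Definition compact_op {X Y} (T : ell2 R X -> ell2 R Y) : Prop :=
  bounded_op T /\ precompact (T @` [set u | ell2_norm u <= 1]).

Definition positive_op {X} (T : ell2 R X -> ell2 R X) : Prop :=
  bounded_op T /\ forall u, 0 <= inner (T u) u.

Definition projection_op {X} (T : ell2 R X -> ell2 R X) : Prop :=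
  [/\ bounded_op T, T \o T = T & adj T = T].

End operators.

Notation op R X := (ell2 R X -> ell2 R X).

(* C*-algebras are concrete: norm-closed *-algebras of bounded operators. *)
Section cstar_algebras.
Context {R : realType} {X : choiceType}.
Implicit Types A B D : set (op R X).

Definition star_algebra A : Prop :=
  [/\ A `<=` bounded_op /\ A 0,
      forall (c : R[i]) S T, A S -> A T -> A (c *: S + T),
      forall S T, A S -> A T -> A (S \o T) &
      forall S, A S -> A (adj S)].

Definition norm_closure A : set (op R X) :=
  [set T | bounded_op T /\
    forall e : R, 0 < e -> exists2 S, A S & opnorm (T - S) < e].

Definition cstar_algebra A : Prop :=
  star_algebra A /\ norm_closure A `<=` A.

Definition abelian_algebra A : Prop :=
  forall S T, A S -> A T -> S \o T = T \o S.

Definition masa A B : Prop :=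
  [/\ cstar_algebra B, B `<=` A, abelian_algebra B &
      forall D, star_algebra D -> abelian_algebra D -> D `<=` A ->
        B `<=` D -> D = B].

Definition approximate_unit_in A B : Prop :=
  exists (I : Type) (le : I -> I -> Prop) (e : I -> op R X),
  [/\ [/\ inhabited I, forall i, le i i,
          forall i j k, le i j -> le j k -> le i k &
          forall i j, exists2 k, le i k & le j k],
      forall i, [/\ B (e i), positive_op (e i) & opnorm (e i) <= 1],
      forall i j, le i j -> positive_op (e j - e i) &
      forall a (r : R), A a -> 0 < r -> exists i0, forall i, le i0 i ->
        opnorm (e i \o a - a) < r /\ opnorm (a \o e i - a) < r].

Definition normalizer A B : set (op R X) :=
  [set a | A a /\ forall b, B b ->
    B (a \o b \o adj a) /\ B (adj a \o b \o a)].

(* A matrix of operators is positive if it is so as an operator on the Hilbert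
   sum of n copies of ell2. *)
Definition positive_opmx n (a : 'I_n -> 'I_n -> op R X) : Prop :=
  forall u : 'I_n -> ell2 R X,
    0 <= \sum_(i < n) \sum_(j < n) inner (a i j (u j)) (u i).

Definition completely_positive A (E : op R X -> op R X) : Prop :=
  forall n (a : 'I_n -> 'I_n -> op R X), (forall i j, A (a i j)) ->
    positive_opmx a -> positive_opmx (fun i j => E (a i j)).

Definition conditional_expectation A B (E : op R X -> op R X) : Prop :=
  [/\ forall a, A a -> B (E a),
      forall (c : R[i]) a b, A a -> A b -> E (c *: a + b) = c *: E a + E b,
      completely_positive A E /\ forall a, A a -> opnorm (E a) <= opnorm a,
      forall b, B b -> E b = b &
      forall b a b', B b -> A a -> B b' ->
        E (b \o a \o b') = b \o E a \o b'].

Definition faithful A (E : op R X -> op R X) : Prop :=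
  forall a, A a -> E (adj a \o a) = 0 -> a = 0.

Definition cartan_masa A B : Prop :=
  [/\ masa A B, approximate_unit_in A B,
      smallest cstar_algebra (normalizer A B) = A &
      exists2 E, conditional_expectation A B E & faithful A E].

End cstar_algebras.

(* Only the values of Phi on A matter. *)
Definition star_isomorphism {R : realType} {X Y : choiceType}
    (A : set (op R X)) (B : set (op R Y)) (Phi : op R X -> op R Y) : Prop :=
  [/\ set_bij A B Phi,
      forall (c : R[i]) S T, A S -> A T -> Phi (c *: S + T) = c *: Phi S + Phi T,
      forall S T, A S -> A T -> Phi (S \o T) = Phi S \o Phi T &
      forall S, A S -> Phi (adj S) = adj (Phi S)].

Section coarse_spaces.
Context {X : choiceType}.
Implicit Types C : set (set (X * X)).
Local Open Scope relation_scope.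

Definition coarse_structure C : Prop :=
  [/\ C diagonal,
      forall E F, C E -> F `<=` E -> C F,
      forall E, C E -> C E^-1,
      forall E F, C E -> C F -> C (E `|` F) &
      forall E F, C E -> C F -> C (E \; F)].

Definition is_metric {R : realType} (d : X -> X -> R) : Prop :=
  [/\ forall x y, 0 <= d x y,
      forall x y, d x y = 0 <-> x = y,
      forall x y, d x y = d y x &
      forall x y z, d x z <= d x y + d y z].

Definition metrizable (R : realType) C : Prop :=
  exists2 d : X -> X -> R, is_metric d &
    C = smallest coarse_structure
          [set [set p | d p.1 p.2 <= r] | r in [set r | 0 <= r]].

Definition uniformly_locally_finite C : Prop :=
  forall E, C E -> exists n, forall x, ([set y | E (x, y)] #<= `I_n)%card.

End coarse_spaces.

Section uniform_roe_algebras.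
Context {R : realType}.
Implicit Types X Y : choiceType.

Definition supp {X} (T : op R X) : set (X * X) :=
  [set p | inner (T (delta p.1)) (delta p.2) != 0].

Definition uniform_roe {X} (C : set (set (X * X))) : set (op R X) :=
  norm_closure [set T | bounded_op T /\ C (supp T)].

Definition ell_infty {X} : set (op R X) :=
  [set T | bounded_op T /\ supp T `<=` diagonal].

Definition ghost {X} (C : set (set (X * X))) (T : op R X) : Prop :=
  uniform_roe C T /\ forall e : R, 0 < e ->
    exists2 F : set X, finite_set F &
      forall x x', ~ F x -> ~ F x' ->
        normc (inner (T (delta x)) (delta x')) < e.

Definition rigidly_implemented {X Y} (C : set (set (X * X)))
    (Phi : op R X -> op R Y) : Prop :=
  exists U : ell2 R X -> ell2 R Y,
  [/\ unitary_op U,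
      forall T, uniform_roe C T -> Phi T = U \o T \o adj U,
      (0 < ereal_inf [set ereal_sup
         [set (normc (inner (U (delta x)) (delta y)))%:E | y in [set: Y]]
         | x in [set: X]])%E &
      (0 < ereal_inf [set ereal_sup
         [set (normc (inner (adj U (delta y)) (delta x)))%:E | x in [set: X]]
         | y in [set: Y]])%E].

Definition ghostly_cartan_masa {X} (C : set (set (X * X)))
    (A : set (op R X)) : Prop :=
  cartan_masa (uniform_roe C) A /\
  exists (J : choiceType) (Q : J -> op R X),
  [/\ forall j, [/\ A (Q j), projection_op (Q j), ghost C (Q j) &
                    ~ compact_op (Q j)],
      forall i j, i <> j -> Q i \o Q j = 0 &
      forall u, partial_sum (Q^~ u) @ totally --> u].

End uniform_roe_algebras.

(* Main.v *)
(** As the algebras contain all rank one operators, Phi = Ad U for a unitary U: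
    Phi maps a rank one projection to a minimal projection, which must be of the
    form |xi><xi|, and U u = Phi(|u><delta_x0|) xi. If U violates one of the
    two lower bounds in the definition of rigidity (the other case is symmetric,
    with U^* in place of U), there are distinct points a_k of X with
    |<U delta_(a_k), delta_y>|^2 <= 2^-(k+1) for all y. If S is the union of a
    set of points a_k and a singleton, then the diagonal coefficient
    sum_(x in S) |<U delta_x, delta_y>|^2 of U 1_S U^* at y tends to 0 as y goes
    to infinity, by domination; as U 1_S U^* is a projection, it is a ghost, and
    it is not compact when S is infinite. Since X is countable, it is a disjoint
    union of such infinite sets S. *)
Require Import Defs.
From mathcomp Require Import all_boot all_order all_algebra finmap.
From mathcomp Require Import all_classical all_reals all_analysis.
From mathcomp Require Import complex ring lra.
From mathcomp Require Import showcase.summability.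

Set Implicit Arguments.
Unset Strict Implicit.
Unset Printing Implicit Defensive.

Import Order.TTheory GRing.Theory Num.Theory numFieldNormedType.Exports.
Import ComplexField.Normc.

Local Open Scope classical_set_scope.
Local Open Scope complex_scope.
Local Open Scope ring_scope.

(** * Complex modulus and convergence along finite subsets *)

(** Nonrigidity yields only the projections; the Cartan property of the image is that of [ell_infty]
    in its own Roe algebra, carried over by conjugation. Its hard clause is generation by
    normalizers: uniform local finiteness bounds the number of neighbours in an entourage, so a
    controlled operator is a finite sum of weighted partial bijections, each of which normalizes
    [ell_infty]. Metrizability enters through two facts: every pair of points is an entourage, which
    puts the rank one operators into the algebra, and X is a countable union of balls, finite by
    uniform local finiteness. The a_k are distinct because all coefficients of U delta_(a_(k+1)) lie
    below one coefficient of U delta_(a_k). The bounds 2^-(k+1) are there for their summability,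
    which gives a domination uniform in y. A point off the sequence has only the trivial bound 1, so
    each S takes at most one of them; an injection of X into nat arranges this. *)

Section complex_modulus.
Context {R : realType}.
Implicit Types z : R[i].

Lemma normc_ge0 z : 0 <= normc z.
Proof. by case: z => a b; exact: Num.Theory.sqrtr_ge0. Qed.

Lemma normrE z : `|z| = (normc z)%:C.
Proof. by []. Qed.

Lemma normc_gt0 z : (0 < normc z) = (z != 0).
Proof.
rewrite lt_neqAle normc_ge0 andbT (eq_sym 0); congr (~~ _).
by apply/eqP/eqP => [/eq0_normc|->]; rewrite ?normc0.
Qed.

Lemma sqr_normcE z : (normc z ^+ 2)%:C = z * z^*%C.
Proof. by rewrite rmorphXn/= -normrE sqr_normc. Qed.

Lemma normc_conj z : normc z^*%C = normc z.
Proof. by apply/complexI; rewrite -!normrE normcJ. Qed.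

Lemma normc_real (a : R) : normc a%:C = `|a|.
Proof. by rewrite /= expr0n addr0 sqrtr_sqr. Qed.

Lemma gt0_complexE z : 0 < z -> exists2 e : R, 0 < e & z = e%:C.
Proof.
rewrite ltcE => /andP[/eqP/= z0 zr]; exists (complex.Re z) => //.
by case: z z0 {zr} => a b /= ->.
Qed.

Lemma normc_eq0_small z : (forall e : R, 0 < e -> normc z <= e) -> z = 0.
Proof.
move=> h; apply/eqP; rewrite -[_ == _]negbK -normc_gt0 -real_leNgt ?num_real//.
by apply/ler_addgt0Pl => e /h; rewrite addr0.
Qed.

(** Nonnegative means a vanishing imaginary part and a nonnegative real part, and the modulus
    controls both parts. Positivity of infinite sums is obtained in this way from that of their
    partial sums. *)
Lemma ge0_complex_closed z :
  (forall e : R, 0 < e -> exists2 w, 0 <= w & normc (z - w) < e) -> 0 <= z.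
Proof.
move=> h.
have hr (e : R) : 0 < e -> `|complex.Im z| <= e /\ - e <= complex.Re z.
  move=> /h[w]; rewrite lecE => /andP[/eqP/= iw rw] /ltW.
  have -> : z - w = (complex.Re z - complex.Re w) +i* (complex.Im z).
    by case: z w iw {rw h} => a b [c d] /= ->; simpc.
  move=> le_e; split.
    apply: le_trans le_e; rewrite -sqrtr_sqr /= ler_sqrt ?addr_ge0 ?sqr_ge0//.
    by rewrite lerDr sqr_ge0.
  have : `|complex.Re z - complex.Re w| <= e.
    apply: le_trans le_e; rewrite -sqrtr_sqr /= ler_sqrt ?addr_ge0 ?sqr_ge0//.
    by rewrite lerDl sqr_ge0.
  by rewrite ler_norml => /andP[+ _]; lra.
rewrite lecE; apply/andP; split.
  rewrite -normr_eq0 eq_le normr_ge0 andbT.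
  by apply/ler_addgt0Pl => e /hr[]; rewrite addr0.
apply/ler_addgt0Pl => e /hr[_]; rewrite -lerBlDl sub0r; exact.
Qed.

End complex_modulus.

Section totally_convergence.
Context {R : realType} {I : choiceType}.

#[local] Existing Instance totally_filter.

Lemma cvg_totallyP {V : normedModType R[i]} (f : {fset I} -> V) (l : V) :
  (f @ totally --> l) <->
  (forall e : R, 0 < e ->
    exists G : {fset I}, forall A, (G `<=` A)%fset -> `|l - f A| < e%:C).
Proof.
split=> [/cvgrPdist_lt h e e0|h].
  have /h [G _ GP] : 0 < e%:C by rewrite ltcR.
  by exists G => A; exact: GP.
apply/cvgrPdist_lt => _ /gt0_complexE[e e0 ->].
have [G GP] := h e e0; exists G => //.
Qed.

Lemma cvg_totally_complexP (f : {fset I} -> R[i]^o) (l : R[i]^o) :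
  (f @ totally --> l) <->
  (forall e : R, 0 < e -> exists G : {fset I},
    forall A, (G `<=` A)%fset -> normc (l - f A : R[i]) < e).
Proof.
rewrite cvg_totallyP; split=> h e /h[G GP]; exists G => A /GP.
  by rewrite normrE ltcR.
by move=> ?; rewrite [X in X < _]normrE ltcR.
Qed.

Lemma partial_sumE {V : zmodType} (x : I -> V) (A : {fset I}) :
  partial_sum x A = \sum_(i <- A) x i.
Proof. by rewrite /partial_sum (big_seq_fsetE _ _ predT). Qed.

Lemma sum_cvg (x : I -> R[i]^o) (l : R[i]^o) :
  partial_sum x @ totally --> l -> sum x = l.
Proof.
exact: (@cvg_lim R[i]^o (@norm_hausdorff _ R[i]^o) _ _ totally_filter).
Qed.

End totally_convergence.

Section esum_tail.
Context {R : realType} {X : choiceType}.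
Implicit Types (a : X -> R).
Local Open Scope ereal_scope.

Lemma fset_le_esum (a : X -> R) (A : {fset X}) : (forall x, (0 <= a x)%R) ->
  (\sum_(x <- A) a x)%R%:E <= \esum_(x in [set: X]) (a x)%:E.
Proof.
move=> a0; rewrite -sumEFin fsbig_seq//; apply: esum_ge.
by exists [set` A].
Qed.

Lemma esum_le_fset (a : X -> R) (S : set X) (M : \bar R) :
  (forall A : {fset X}, [set` A] `<=` S -> (\sum_(x <- A) a x)%R%:E <= M) ->
  \esum_(x in S) (a x)%:E <= M.
Proof.
move=> h; apply: ge_ereal_sup => _ [A [finA AS] <-].
rewrite fsbig_finite// sumEFin; apply: h => x /=; rewrite in_fset_set// inE.
exact: AS.
Qed.

Lemma esum_tail (a : X -> R) (S : set X) (e : R) : (forall x, (0 <= a x)%R) ->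
  \esum_(x in S) (a x)%:E < +oo -> (0 < e)%R ->
  exists G : {fset X}, \esum_(x in S `&` ~` [set` G]) (a x)%:E < e%:E.
Proof.
move=> a0 fin e0.
have aE0 x : 0 <= (a x)%:E by rewrite lee_fin.
have s0 : 0 <= \esum_(x in S) (a x)%:E by exact: esum_ge0.
have sfin : \esum_(x in S) (a x)%:E \is a fin_num by rewrite ge0_fin_numE.
have [_ [A [finA AS] <-] lt] := ub_ereal_sup_adherent e0 sfin.
exists (fset_set A); rewrite fset_setK//.
have Afin : \sum_(x \in A) (a x)%:E \is a fin_num by rewrite fsbig_finite// sumEFin.
move: lt; rewrite -/(esum _ _) (esumID A)// setIidr// esum_fset//.
rewrite lteBlDr// lteD2lE//.
Qed.

End esum_tail.

(** * Weighted partial injections *)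

Section weighted_partial_injections.
Context {R : realType}.

(** [t] points from the target to the source: being a function, it lets [y] receive from at most one
    [x]; the condition says that [x] feeds at most one [y]. *)
Definition partial_injection {X Y : choiceType} (t : Y -> option X) : Prop :=
  forall y y' x, t y = Some x -> t y' = Some x -> y = y'.

Definition wpi_fun {X Y : choiceType} (t : Y -> option X) (a : Y -> R[i])
    (u : ell2 R X) : Y -> R[i]^o :=
  fun y => if t y is Some x then a y * (u x : R[i]) else 0.

(* [insubd] returns 0 when the weights are unbounded. *)
Definition wpi {X Y : choiceType} (t : Y -> option X) (a : Y -> R[i])
    (u : ell2 R X) : ell2 R Y := insubd (0 : ell2 R Y) (wpi_fun t a u).

Context {X Y : choiceType}.
Implicit Types (t : Y -> option X) (a : Y -> R[i]) (u v : ell2 R X).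

(** Injectivity reindexes the sum over the domain of [t] by points of [X], which makes it a part of
    the sum for [u]. *)
Lemma sqsum_wpi_le t a (M : R) u : partial_injection t -> 0 <= M ->
  (forall y, normc (a y) <= M) ->
  (sqsum (wpi_fun t a u) <= (M ^+ 2)%:E * sqsum u)%E.
Proof.
move=> tinj M0 aM.
have [[y0 y0P]|none] := pselect (exists y, t y <> None); last first.
  rewrite {1}/sqsum esum1 ?mule_ge0 ?sqsum_ge0 ?lee_fin ?sqr_ge0// => y _.
  rewrite /wpi_fun; case ty : (t y) => [x|]; last by rewrite normc0 expr0n.
  by case: none; exists y; rewrite ty.
have [x0 _] : exists x : X, True by case: (t y0) y0P => // x _; exists x.
(* Reindexing uses a total map; the default [x0] is never taken on [D]. An empty domain was split
   off because [X] may then be empty. *)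
pose s y := odflt x0 (t y); pose D := [set y | t y <> None].
have sinj : set_inj D s.
  move=> y y'; rewrite !inE /D /s /=.
  case ty : (t y) => [x|//]; case ty' : (t y') => [x'|//] _ _ /= xx'.
  by apply: tinj ty _; rewrite ty' xx'.
rewrite {1}/sqsum.
rewrite (eq_esum (b := fun y => if y \in D then
    ((normc (a y) * normc (u (s y) : R[i])) ^+ 2)%:E else 0%E)); last first.
  move=> y _; rewrite /wpi_fun /D /s; case ty : (t y) => [x|].
    by rewrite normcM mem_set//= ty.
  by rewrite memNset ?normc0 ?expr0n//= ty; apply.
rewrite -esum_mkcond.
apply: le_trans (_ : \esum_(y in D) ((M ^+ 2)%:E *
    (normc (u (s y) : R[i]) ^+ 2)%:E) <= _)%E.
  apply: le_esum => y _; rewrite -EFinM lee_fin -exprMn ler_sqr ?nnegrE.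
  - by rewrite ler_wpM2r ?normc_ge0.
  - by rewrite mulr_ge0 ?normc_ge0.
  - by rewrite mulr_ge0 ?normc_ge0.
rewrite -(esum_image D s (fun x => (M ^+ 2)%:E * (normc (u x : R[i]) ^+ 2)%:E))%E//.
apply: le_trans (esumZ_le (sqr_ge0 M) _); last first.
  by move=> x; rewrite lee_fin sqr_ge0.
rewrite esum_mkcond; apply: le_esum => x _; case: ifP => // _.
by rewrite -EFinM lee_fin mulr_ge0// sqr_ge0.
Qed.

Lemma wpiE t a (M : R) u y : partial_injection t ->
  (forall y, normc (a y) <= M) ->
  wpi t a u y = if t y is Some x then a y * (u x : R[i]) else 0 :> R[i].
Proof.
move=> tinj aM; rewrite /wpi insubdK// inE.
have M0 : 0 <= M by apply: le_trans (aM y); exact: normc_ge0.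
apply: le_lt_trans (sqsum_wpi_le u tinj M0 aM) _.
by rewrite sqsumE -EFinM ltry.
Qed.

Lemma ell2_norm_wpi t a (M : R) u : partial_injection t -> 0 <= M ->
  (forall y, normc (a y) <= M) -> ell2_norm (wpi t a u) <= M * ell2_norm u.
Proof.
move=> tinj M0 aM.
rewrite -ler_sqr ?nnegrE ?mulr_ge0 ?ell2_norm_ge0// exprMn.
rewrite -lee_fin [leRHS]EFinM -!sqsumE.
rewrite (_ : ell2_fun (wpi t a u) = wpi_fun t a u); first exact: sqsum_wpi_le.
by apply/funext => y; rewrite (wpiE _ _ tinj aM).
Qed.

End weighted_partial_injections.

Section diagonal_operators.
Context {R : realType} {X : choiceType}.
Implicit Types (a : X -> R[i]) (S : set X) (u : ell2 R X).

Definition diag a : op R X := wpi Some a.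

Lemma partial_injection_Some : partial_injection (@Some X).
Proof. by move=> x y z [->] [->]. Qed.

Lemma diagE a (M : R) u x : (forall x, normc (a x) <= M) ->
  diag a u x = a x * (u x : R[i]) :> R[i].
Proof. by move=> aM; rewrite /diag (wpiE _ _ partial_injection_Some aM). Qed.

Definition indic_op S : op R X := diag (fun x => (x \in S)%:R).

Lemma normc_indic_le1 S x : normc ((x \in S)%:R : R[i]) <= 1.
Proof. by case: (x \in S); rewrite ?normc0 ?normc1. Qed.

Lemma indic_opE S u x : indic_op S u x = if x \in S then u x else 0 :> R[i].
Proof.
rewrite /indic_op (diagE _ _ (normc_indic_le1 S)).
by case: (x \in S); rewrite ?mul1r ?mul0r.
Qed.

Lemma sqr_norm_indic_op S u :
  ((ell2_norm (indic_op S u)) ^+ 2)%:E =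
  (\esum_(x in S) (normc (u x : R[i]) ^+ 2)%:E)%E.
Proof.
rewrite -sqsumE esum_mkcond; apply: eq_esum => x _; rewrite indic_opE.
by case: ifP => //; rewrite normc0 expr0n.
Qed.

Lemma ell2P (u v : ell2 R X) : (forall x, u x = v x :> R[i]) -> u = v.
Proof. by move=> h; apply/val_inj/funext => x; exact: h. Qed.

Lemma ell2_addE u v x : (u + v) x = (u x : R[i]) + (v x : R[i]) :> R[i].
Proof. by []. Qed.

Lemma ell2_scaleE (c : R[i]) u x : (c *: u) x = c * (u x : R[i]) :> R[i].
Proof. by []. Qed.

Lemma ell2_oppE u x : (- u) x = - (u x : R[i]) :> R[i].
Proof. by []. Qed.

Lemma ell2_sumE (I : Type) (s : seq I) (P : pred I) (f : I -> ell2 R X) x :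
  (\sum_(i <- s | P i) f i) x = \sum_(i <- s | P i) (f i x : R[i]) :> R[i].
Proof. by elim/big_ind2 : _ => // u c v d <- <-. Qed.

Lemma deltaE x y : (delta x : ell2 R X) y = (y == x)%:R :> R[i].
Proof. by []. Qed.

Lemma ell2_normE_le u (S : set X) :
  (\esum_(x in S) (normc (u x : R[i]) ^+ 2)%:E <= (ell2_norm u ^+ 2)%:E)%E.
Proof.
rewrite -sqsumE [leLHS]esum_mkcond; apply: le_esum => x _; case: ifP => // _.
by rewrite lee_fin sqr_ge0.
Qed.

Lemma normc_le_norm u x : normc (u x : R[i]) <= ell2_norm u.
Proof.
rewrite -ler_sqr ?nnegrE ?ell2_norm_ge0 ?normc_ge0//.
have := ell2_normE_le u [set x].
by rewrite esum_set1 ?lee_fin ?sqr_ge0.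
Qed.

Lemma ell2_normN u : ell2_norm (- u) = ell2_norm u.
Proof. by rewrite -scaleN1r ell2_normZ normcN normc1 mul1r. Qed.

Lemma ell2_norm0 : ell2_norm (0 : ell2 R X) = 0.
Proof. by rewrite -(scale0r (0 : ell2 R X)) ell2_normZ normc0 mul0r. Qed.

(** The error is a tail of the sum of squares. All supersets of [G] are allowed, infinite ones
    included, since [range_proj_sum] truncates to unions of blocks of a partition. *)
Lemma finite_approx u (e : R) : 0 < e ->
  exists G : {fset X}, forall S, [set` G] `<=` S ->
    ell2_norm (u - indic_op S u) < e.
Proof.
move=> e0; have e20 : 0 < e ^+ 2 by rewrite exprn_gt0.
have := @esum_tail R X (fun x => normc (u x : R[i]) ^+ 2) setT _
  (fun=> sqr_ge0 _) _ e20.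
case; first by have := valP u; rewrite inE.
move=> G; rewrite setTI => Ge; exists G => S GS.
rewrite -ltr_sqr ?nnegrE ?ell2_norm_ge0 ?(ltW e0)// -lte_fin.
rewrite (_ : u - _ = indic_op (~` S) u); last first.
  apply: ell2P => x; rewrite ell2_addE ell2_oppE !indic_opE in_setC.
  by case: (x \in S); rewrite ?subrr ?subr0.
rewrite sqr_norm_indic_op; apply: le_lt_trans Ge.
rewrite [leLHS]esum_mkcond [leRHS]esum_mkcond; apply: le_esum => x _.
case: ifPn => [xS|_]; last by case: ifP => //; rewrite lee_fin sqr_ge0.
rewrite mem_set//= => xG; move: xS; rewrite in_setC => /negP; apply.
by rewrite mem_set//; exact: GS.
Qed.

Lemma indic_op_fset (G : {fset X}) u :
  indic_op [set` G] u = \sum_(x <- G) (u x : R[i]) *: delta x.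
Proof.
apply: ell2P => y; rewrite indic_opE ell2_sumE.
under eq_bigr do rewrite ell2_scaleE deltaE.
have -> : (y \in [set` G]) = (y \in G) by apply/idP/idP; rewrite inE.
have [yG|yG] := boolP (y \in G).
  rewrite (big_fsetD1 y)//= eqxx mulr1 big_seq big1 ?addr0// => x.
  by rewrite !inE eq_sym => /andP[/negPf -> _]; rewrite mulr0.
rewrite big_seq big1// => x xG; rewrite (_ : (y == x) = false) ?mulr0//.
by apply: contraNF yG => /eqP ->.
Qed.

End diagonal_operators.

(** * The inner product *)

Section inner_product_theory.
Context {R : realType} {X : choiceType}.
Implicit Types (u v w : ell2 R X) (c : R[i]).

#[local] Existing Instance totally_filter.

Let sqrc u (x : X) : R[i]^o := (normc (u x : R[i]) ^+ 2)%:C.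

Let sqrc_cvg u : partial_sum (sqrc u) @ totally --> ((ell2_norm u ^+ 2)%:C :
  R[i]^o).
Proof.
apply/cvg_totally_complexP => e e0.
have := @esum_tail R X (fun x => normc (u x : R[i]) ^+ 2) setT e
  (fun=> sqr_ge0 _) _ e0.
case; first by have := valP u; rewrite inE.
move=> G; rewrite setTI => Ge; exists G => A GA.
have -> : ((ell2_norm u ^+ 2)%:C : R[i]^o) - partial_sum (sqrc u) A =
   (ell2_norm u ^+ 2 - \sum_(x <- A) normc (u x : R[i]) ^+ 2)%:C :> R[i].
  by rewrite partial_sumE /sqrc rmorphB rmorph_sum.
have le : \sum_(x <- A) normc (u x : R[i]) ^+ 2 <= ell2_norm u ^+ 2.
  rewrite -lee_fin -sqsumE.
  exact: (@fset_le_esum R X (fun x => normc (u x : R[i]) ^+ 2) A (fun=> sqr_ge0 _)).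
rewrite normc_real ger0_norm ?subr_ge0// -lte_fin; apply: le_lt_trans Ge.
rewrite EFinB -sqsumE leeBlDl// [sqsum u](esumID [set` A])//; last first.
  by move=> x _; rewrite lee_fin sqr_ge0.
rewrite !setTI esum_fset//; last by move=> x _; rewrite lee_fin sqr_ge0.
rewrite -fsbig_seq// sumEFin leeD2lE// [leLHS]esum_mkcond [leRHS]esum_mkcond.
apply: le_esum => x _; case: ifPn => [xA|_]; last first.
  by case: ifP => //; rewrite lee_fin sqr_ge0.
rewrite mem_set//= => xG; move: xA; rewrite in_setC => /negP; apply.
by rewrite mem_set//; exact: (fsubsetP GA).
Qed.

(* By polarization, convergence reduces to that of sums of squares. *)
Lemma inner_cvg u v :
  partial_sum (fun x => (u x : R[i]) * (v x : R[i])^*%C : R[i]^o) @ totally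
    --> (inner u v : R[i]^o).
Proof.
(* The imaginary unit is known only through these two identities, so that [field] treats it as a
   variable; [l] is the polarization formula. *)
have [j jc jj] : exists2 j : R[i], j^*%C = - j & j * j = -1.
  by exists 'i%C; [simpc|rewrite -expr2 sqr_i].
pose l : R[i]^o := 4^-1 *: (((ell2_norm (u + v) ^+ 2)%:C - (ell2_norm (u - v)
  ^+ 2)%:C
  + j *: ((ell2_norm (u + j *: v) ^+ 2)%:C - (ell2_norm (u - j *: v) ^+ 2)%:C))
    : R[i]^o).
suff h : partial_sum (fun x => (u x : R[i]) * (v x : R[i])^*%C : R[i]^o) @
  totally --> l.
  by rewrite /inner (sum_cvg h).
rewrite (_ : partial_sum _ = fun A => 4^-1 *: (partial_sum (sqrc (u + v)) A
   - partial_sum (sqrc (u - v)) A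
   + j *: (partial_sum (sqrc (u + j *: v)) A -
           partial_sum (sqrc (u - j *: v)) A)) : R[i]^o).
  apply: cvgZr; apply: cvgD; last apply: cvgZr; apply: cvgB; exact: sqrc_cvg.
apply/funext => A; rewrite !partial_sumE -!sumrB scaler_sumr -big_split scaler_sumr.
apply: eq_bigr => x _; rewrite /sqrc !sqr_normcE !ell2_addE !ell2_oppE !ell2_scaleE.
rewrite /GRing.scale/= !rmorphD !rmorphN !rmorphM/=.
rewrite jc.
set a := (u x : R[i]); set b := (v x : R[i]).
transitivity (4^-1 * (2 * (a * b^*%C + b * a^*%C) + 2 * - (j * j) * (a * b^*%C
  - b * a^*%C))).
  by rewrite jj opprK; field.
by field.
Qed.

Lemma inner_unique u v (l : R[i]) :
  partial_sum (fun x => (u x : R[i]) * (v x : R[i])^*%C : R[i]^o) @ totally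
    --> (l : R[i]^o) -> inner u v = l.
Proof. exact: sum_cvg. Qed.

Lemma innerDl u v w : inner (u + v) w = inner u w + inner v w.
Proof.
apply: inner_unique.
rewrite (_ : partial_sum _ = fun A =>
  partial_sum (fun x => (u x : R[i]) * (w x : R[i])^*%C : R[i]^o) A +
  partial_sum (fun x => (v x : R[i]) * (w x : R[i])^*%C : R[i]^o) A).
  by apply: cvgD; exact: inner_cvg.
apply/funext => A; rewrite !partial_sumE -big_split; apply: eq_bigr => x _.
exact: mulrDl.
Qed.

Lemma innerZl c u w : inner (c *: u) w = c * inner u w.
Proof.
apply: inner_unique.
rewrite (_ : partial_sum _ = fun A =>
  c *: partial_sum (fun x => (u x : R[i]) * (w x : R[i])^*%C : R[i]^o) A).
  by apply: cvgZr; exact: inner_cvg.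
apply/funext => A; rewrite !partial_sumE scaler_sumr; apply: eq_bigr => x _.
exact/esym/mulrA.
Qed.

Lemma inner_conj u v : (inner u v)^*%C = inner v u.
Proof.
apply/esym/inner_unique/cvg_totally_complexP => e e0.
have /cvg_totally_complexP/(_ e e0)[G GP] := @inner_cvg u v.
exists G => A /GP; rewrite -normc_conj; congr (normc _ < _).
rewrite rmorphB/= !partial_sumE; congr (_ - _).
rewrite (rmorph_sum (@conjc R)); apply: eq_bigr => x _.
by rewrite rmorphM /= conjcK mulrC.
Qed.

Lemma innerNl u w : inner (- u) w = - inner u w.
Proof. by rewrite -scaleN1r innerZl mulN1r. Qed.

Lemma innerBl u v w : inner (u - v) w = inner u w - inner v w.
Proof. by rewrite innerDl innerNl. Qed.

Lemma inner0l w : inner 0 w = 0.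
Proof. by rewrite -(scale0r (0 : ell2 R X)) innerZl mul0r. Qed.

Lemma innerDr u v w : inner w (u + v) = inner w u + inner w v.
Proof. by rewrite -inner_conj innerDl rmorphD /= !inner_conj. Qed.

Lemma innerZr c u w : inner w (c *: u) = c^*%C * inner w u.
Proof. by rewrite -inner_conj innerZl rmorphM /= !inner_conj. Qed.

Lemma innerBr u v w : inner w (u - v) = inner w u - inner w v.
Proof. by rewrite -inner_conj innerBl rmorphB /= !inner_conj. Qed.

Lemma inner0r w : inner w 0 = 0.
Proof. by rewrite -inner_conj inner0l conjc0. Qed.

Lemma inner_suml (I : Type) (s : seq I) (P : pred I) (f : I -> ell2 R X) w :
  inner (\sum_(i <- s | P i) f i) w = \sum_(i <- s | P i) inner (f i) w.
Proof.
by elim/big_ind2 : _ => [|u a v b <- <-|//]; rewrite ?inner0l ?innerDl.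
Qed.

Lemma inner_sumr (I : Type) (s : seq I) (P : pred I) (f : I -> ell2 R X) w :
  inner w (\sum_(i <- s | P i) f i) = \sum_(i <- s | P i) inner w (f i).
Proof.
by elim/big_ind2 : _ => [|u a v b <- <-|//]; rewrite ?inner0r ?innerDr.
Qed.

Lemma inner_norm u : inner u u = (ell2_norm u ^+ 2)%:C.
Proof.
apply: inner_unique; rewrite (_ : (fun x => _) = sqrc u); first exact: sqrc_cvg.
by apply/funext => x; rewrite /sqrc sqr_normcE.
Qed.

Lemma inner_ge0 u : 0 <= inner u u.
Proof. by rewrite inner_norm ler0c sqr_ge0. Qed.

Lemma inner_eq0 u : inner u u = 0 -> u = 0.
Proof.
rewrite inner_norm => /complexI/eqP; rewrite sqrf_eq0 => /eqP.
exact: ell2_norm0_eq0.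
Qed.

Lemma inner_inj u v : (forall w, inner u w = inner v w) -> u = v.
Proof.
by move=> h; apply/eqP; rewrite -subr_eq0; apply/eqP/inner_eq0;
  rewrite innerBl h subrr.
Qed.

Lemma inner_injr u v : (forall w, inner w u = inner w v) -> u = v.
Proof. by move=> h; apply: inner_inj => w; rewrite -inner_conj h inner_conj. Qed.

Lemma delta_inner u (x : X) : inner (delta x) u = (u x : R[i])^*%C.
Proof. by rewrite -inner_conj inner_delta. Qed.

Lemma cauchy_schwarz u v : normc (inner u v) <= ell2_norm u * ell2_norm v.
Proof.
set c := inner u v.
have [/ell2_norm0_eq0 v0|v0] := eqVneq (ell2_norm v) 0.
  by rewrite /c v0 inner0r normc0 ell2_norm0 mulr0.
have v1 : 0 < ell2_norm v by rewrite lt_neqAle eq_sym v0 ell2_norm_ge0.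
set b := ell2_norm v ^+ 2.
(* This vector is [b] times the component of [u] orthogonal to [v]; the factor avoids a division,
   and the square of its norm is [b * (b * |u|^2 - |c|^2)]. *)
have := inner_ge0 (b%:C *: u - c *: v).
rewrite innerBl !innerBr !innerZl !innerZr !inner_norm -/b conjc_real.
rewrite -(inner_conj u v) -/c.
have -> : b%:C * (b%:C * (ell2_norm u ^+ 2)%:C) - b%:C * (c^*%C * c) -
   (c * (b%:C * c^*%C) - c * (c^*%C * b%:C)) =
   (b * (b * ell2_norm u ^+ 2 - normc c ^+ 2))%:C.
  have -> (p q r : R) : (p * (p * q - r))%:C = p%:C * (p%:C * q%:C - r%:C).
    by rewrite rmorphM rmorphB rmorphM.
  by rewrite sqr_normcE; ring.
rewrite ler0c pmulr_rge0 ?exprn_gt0// subr_ge0 -exprMn ler_sqr ?nnegrE ?normc_ge0//.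
  by rewrite mulrC.
by rewrite mulr_ge0 ?ell2_norm_ge0.
Qed.

Lemma norm_delta (x : X) : ell2_norm (delta x : ell2 R X) = 1.
Proof.
have : (ell2_norm (delta x : ell2 R X) ^+ 2)%:C = 1 :> R[i].
  by rewrite -inner_norm inner_delta deltaE eqxx.
rewrite -(rmorph1 (real_complex R)) => /complexI/eqP.
by rewrite sqrf_eq1 => /orP[/eqP//|/eqP h];
  have := ell2_norm_ge0 (delta x : ell2 R X); rewrite h; lra.
Qed.

Lemma ell2_norm_le_inner (M : R) u : 0 <= M ->
  (forall w, normc (inner u w) <= M * ell2_norm w) -> ell2_norm u <= M.
Proof.
move=> M0 /(_ u); rewrite inner_norm normc_real ger0_norm ?sqr_ge0// expr2.
have [->//|u0] := eqVneq (ell2_norm u) 0.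
by rewrite ler_pM2r// lt_neqAle eq_sym u0 ell2_norm_ge0.
Qed.

End inner_product_theory.

(** * Bounded operators and adjoints *)

Section bounded_operators.
Context {R : realType}.

Lemma normr_ell2E {X : choiceType} (u : ell2 R X) : `|u| = (ell2_norm u)%:C.
Proof. by []. Qed.

Section one_operator.
Context {X Y : choiceType}.
Implicit Types (S T : ell2 R X -> ell2 R Y) (u v : ell2 R X).

Lemma linear_comb T : linear T ->
  forall (c : R[i]) u v, T (c *: u + v) = c *: T u + T v.
Proof. by move=> lT c u v; rewrite lT. Qed.

Lemma linear_add T u v : linear T -> T (u + v) = T u + T v.
Proof. by move=> /linear_comb lT; rewrite -{1}(scale1r u) lT scale1r. Qed.

Lemma linear_zero T : linear T -> T 0 = 0.
Proof.
by move=> /linear_add lT; apply/eqP; rewrite -(inj_eq (addrI (T 0))) -lT !addr0.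
Qed.

Lemma linear_scale T (c : R[i]) u : linear T -> T (c *: u) = c *: T u.
Proof.
by move=> lT; rewrite -{1}(addr0 (c *: u)) (linear_comb lT) (linear_zero lT) addr0.
Qed.

Lemma linear_sub T u v : linear T -> T (u - v) = T u - T v.
Proof.
by move=> lT; rewrite (linear_add _ _ lT) -scaleN1r (linear_scale _ _ lT) scaleN1r.
Qed.

Lemma linear_bigsum T (I : Type) (s : seq I) (P : pred I) (f : I -> ell2 R X) :
  linear T -> T (\sum_(i <- s | P i) f i) = \sum_(i <- s | P i) T (f i).
Proof.
move=> lT; elim/big_ind2 : _ => [|u a v b <- <-|//]; first exact: linear_zero.
exact: linear_add.
Qed.

Lemma bounded_op_bound (M : R) T : linear T ->
  (forall u, ell2_norm (T u) <= M * ell2_norm u) -> bounded_op T.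
Proof.
move=> lT TM; split=> // u;
  apply/(@cvgrPdist_lt _ _ _ (nbhs u) (nbhs_filter u)) => _ /gt0_complexE[e e0 ->].
(* [M] may be negative or zero, and the modulus of continuity divides by this bound. *)
have M1 : 0 < `|M| + 1 by rewrite ltr_wpDl.
apply/nbhs_ballP; exists (e / (`|M| + 1))%:C; first by rewrite /= ltcR divr_gt0.
move=> v; rewrite -ball_normE /= !normr_ell2E -(linear_sub _ _ lT) !ltcR.
rewrite ltr_pdivlMr// mulrC; apply: le_lt_trans.
apply: le_trans (TM _) _; rewrite ler_wpM2r ?ell2_norm_ge0//.
by apply: le_trans (ler_norm _) _; rewrite lerDl.
Qed.

Lemma bounded_op_ex_bound T : bounded_op T ->
  exists2 M : R, 0 < M & forall u, ell2_norm (T u) <= M * ell2_norm u.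
Proof.
move=> [lT cT].
have /cvgrPdist_lt /(_ 1 ltr01) := cT 0.
rewrite (linear_zero lT) => /nbhs_ballP[_ /= /gt0_complexE[d d0 ->]] dP.
exists (2 / d); first by rewrite divr_gt0.
move=> u; have [->|u0] := eqVneq u 0.
  by rewrite (linear_zero lT) !ell2_norm0 mulr0.
have nu0 : 0 < ell2_norm u.
  rewrite lt_neqAle ell2_norm_ge0 andbT eq_sym.
  by apply: contra u0 => /eqP/ell2_norm0_eq0/eqP.
(* The rescaled vector has norm [d / 2], strictly inside the ball on which continuity at 0 makes [T]
   smaller than 1; hence the constant [2 / d]. *)
pose c := d / 2 / ell2_norm u.
have c0 : 0 < c by rewrite !divr_gt0.
have : ball (0 : ell2 R X) d%:C (c%:C *: u).
  rewrite -ball_normE /= sub0r normr_ell2E ell2_normN ltcR.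
  rewrite ell2_normZ normc_real gtr0_norm// /c divfK ?gt_eqF//.
  by rewrite ltr_pdivrMr// ltr_pMr// ltr1n.
move/dP; rewrite /= sub0r normr_ell2E ell2_normN.
rewrite -(rmorph1 (real_complex R)) ltcR (linear_scale _ _ lT) ell2_normZ.
rewrite normc_real gtr0_norm// -ltr_pdivlMl// mulr1 => /ltW Tc.
apply: le_trans Tc _; rewrite /c le_eqVlt; apply/orP; left; apply/eqP; field.
by rewrite !gt_eqF.
Qed.

Lemma opnorm_le T (M : R) : 0 <= M ->
  (forall u, ell2_norm (T u) <= M * ell2_norm u) -> opnorm T <= M.
Proof.
move=> M0 TM; apply: ge_sup.
  by exists (ell2_norm (T 0)); exists 0; rewrite //= ell2_norm0.
move=> _ [u /= u1 <-]; apply: le_trans (TM u) _; exact: ler_piMr.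
Qed.

Lemma opnorm_has_sup T : bounded_op T ->
  has_sup [set ell2_norm (T u) | u in [set u | ell2_norm u <= 1]].
Proof.
move=> /bounded_op_ex_bound[M M0 TM]; split.
  by exists (ell2_norm (T 0)); exists 0; rewrite //= ell2_norm0.
exists M => _ [u /= u1 <-]; apply: le_trans (TM u) _; apply: ler_piMr => //.
exact: ltW.
Qed.

Lemma opnorm_ge0 T : 0 <= opnorm T.
Proof.
have [hs|/sup_out] := pselect (has_sup [set ell2_norm (T u) | u in [set u |
  ell2_norm u <= 1]]).
  apply: le_trans (ell2_norm_ge0 (T 0)) _; apply: (ub_le_sup hs.2).
  by exists 0; rewrite //= ell2_norm0.
by rewrite /opnorm => ->.
Qed.

Lemma le_opnorm T u : bounded_op T -> ell2_norm (T u) <= opnorm T * ell2_norm u.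
Proof.
move=> bT; have [lT _] := bT.
have [u0|u0] := eqVneq (ell2_norm u) 0.
  by rewrite (ell2_norm0_eq0 u0) (linear_zero lT) !ell2_norm0 mulr0.
have nu0 : 0 < ell2_norm u by rewrite lt_neqAle eq_sym u0 ell2_norm_ge0.
rewrite -ler_pdivrMr//.
have -> : ell2_norm (T u) / ell2_norm u = ell2_norm (T ((ell2_norm u)^-1%:C *: u)).
  rewrite (linear_scale _ _ lT) ell2_normZ normc_real gtr0_norm ?invr_gt0//.
  by rewrite mulrC.
apply: (ub_le_sup (opnorm_has_sup bT).2).
exists ((ell2_norm u)^-1%:C *: u) => //=.
by rewrite ell2_normZ normc_real gtr0_norm ?invr_gt0// mulVf.
Qed.

Lemma bounded_op0 : bounded_op (0 : ell2 R X -> ell2 R Y).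
Proof.
apply: (@bounded_op_bound 0) => [c u v|u]; first by rewrite scaler0 addr0.
by rewrite ell2_norm0 mul0r.
Qed.

Lemma op_combE S T (c : R[i]) u : (c *: S + T) u = c *: S u + T u.
Proof. by []. Qed.

Lemma op_subE S T u : (S - T) u = S u - T u.
Proof. by []. Qed.

Lemma op_addE S T u : (S + T) u = S u + T u.
Proof. by []. Qed.

Lemma bounded_op_comb S T (c : R[i]) :
  bounded_op S -> bounded_op T -> bounded_op (c *: S + T).
Proof.
move=> [lS cS] [lT cT].
apply: (@bounded_op_bound (normc c * opnorm S + opnorm T)) => [a u v|u].
  rewrite !op_combE (linear_comb lS) (linear_comb lT) !scalerDr !scalerA.
  by rewrite (mulrC c) addrACA.
rewrite op_combE; apply: le_trans (ler_ell2_normD _ _) _.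
rewrite ell2_normZ mulrDl -mulrA lerD//; last exact: le_opnorm.
by rewrite ler_wpM2l ?normc_ge0//; exact: le_opnorm.
Qed.

Lemma bounded_op_sub S T : bounded_op S -> bounded_op T -> bounded_op (S - T).
Proof.
move=> bS bT; rewrite (_ : S - T = (-1) *: T + S); first exact: bounded_op_comb.
by rewrite scaleN1r addrC.
Qed.

Lemma opnorm_comb S T (c : R[i]) : bounded_op S -> bounded_op T ->
  opnorm (c *: S + T) <= normc c * opnorm S + opnorm T.
Proof.
move=> bS bT; apply: opnorm_le.
  by rewrite addr_ge0 ?mulr_ge0 ?opnorm_ge0 ?normc_ge0.
move=> u; rewrite op_combE; apply: le_trans (ler_ell2_normD _ _) _.
rewrite ell2_normZ mulrDl -mulrA lerD//; last exact: le_opnorm.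
by rewrite ler_wpM2l ?normc_ge0//; exact: le_opnorm.
Qed.

(** The difference vanishes on finite combinations of basis vectors, which are dense, and it is
    bounded. *)
Lemma bounded_op_ext S T : bounded_op S -> bounded_op T ->
  (forall x, S (delta x) = T (delta x)) -> S = T.
Proof.
move=> bS bT ST; apply/funext => u; apply/eqP; rewrite -subr_eq0 -op_subE.
set D := S - T; have bD : bounded_op D := bounded_op_sub bS bT.
have Dd x : D (delta x) = 0 by rewrite /D op_subE ST subrr.
have [M M0 DM] := bounded_op_ex_bound bD.
apply/eqP/ell2_norm0_eq0/eqP; rewrite eq_le ell2_norm_ge0 andbT.
apply/ler_addgt0Pl => e e0; rewrite addr0.
have [G /(_ [set` G] (@subset_refl _ _))] := finite_approx u (divr_gt0 e0 M0).
rewrite ltr_pdivlMr// mulrC => /ltW; apply: le_trans.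
rewrite (_ : D u = D (u - indic_op [set` G] u)) ?DM//.
rewrite (linear_sub _ _ bD.1) indic_op_fset (linear_bigsum _ _ _ bD.1) big1
  ?subr0// => x _.
by rewrite (linear_scale _ _ bD.1) Dd scaler0.
Qed.

End one_operator.

Section composition.
Context {X Y Z : choiceType}.

Lemma bounded_op_comp (S : ell2 R Y -> ell2 R Z) (T : ell2 R X -> ell2 R Y) :
  bounded_op S -> bounded_op T -> bounded_op (S \o T).
Proof.
move=> bS bT; have [lS _] := bS; have [lT _] := bT.
apply: (@bounded_op_bound _ _ (opnorm S * opnorm T)) => [a u v /=|u /=].
  by rewrite (linear_comb lT) (linear_comb lS).
apply: le_trans (le_opnorm _ bS) _; rewrite -mulrA ler_wpM2l ?opnorm_ge0//.
exact: le_opnorm.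
Qed.

Lemma opnorm_comp (S : ell2 R Y -> ell2 R Z) (T : ell2 R X -> ell2 R Y) :
  bounded_op S -> bounded_op T -> opnorm (S \o T) <= opnorm S * opnorm T.
Proof.
move=> bS bT; apply: opnorm_le => [|u /=]; first by rewrite mulr_ge0 ?opnorm_ge0.
apply: le_trans (le_opnorm _ bS) _; rewrite -mulrA ler_wpM2l ?opnorm_ge0//.
exact: le_opnorm.
Qed.

Lemma bounded_op_id : bounded_op (id : op R X).
Proof. by apply: (@bounded_op_bound _ _ 1) => // u; rewrite mul1r. Qed.

Lemma opnorm0 : opnorm (0 : ell2 R X -> ell2 R Y) = 0.
Proof.
apply/eqP; rewrite eq_le opnorm_ge0 andbT; apply: opnorm_le => // u.
by rewrite ell2_norm0 mul0r.
Qed.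

End composition.

Section adjoint.
Context {X Y : choiceType}.
Implicit Types (S T : ell2 R X -> ell2 R Y) (u : ell2 R X) (v : ell2 R Y).

(** These are the coordinates that the adjoint must give to [v]. For the finite vector [u] with
    these coordinates, [inner (T u) v = inner u u = s], so Cauchy-Schwarz bounds [s] by [M] times
    its square root, and every finite subsum [s] is at most [M ^ 2]. *)
Lemma adj_fun_l2 T v : bounded_op T ->
  (fun x => (inner (T (delta x)) v)^*%C : R[i]^o) \in l2.
Proof.
move=> bT; have [lT _] := bT; rewrite inE.
pose M := opnorm T * ell2_norm v.
apply: (@le_lt_trans _ _ (M ^+ 2)%:E); last exact: ltry.
apply: esum_le_fset => A _; rewrite lee_fin.
pose u := \sum_(x <- A) (inner (T (delta x)) v)^*%C *: delta x : ell2 R X.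
have uE : inner (T u) v = (\sum_(x <- A) normc ((inner (T (delta x)) v)^*%C) ^+
  2)%:C.
  rewrite /u (linear_bigsum _ _ _ lT) inner_suml (rmorph_sum (real_complex R));
    apply: eq_bigr => x _.
  rewrite (linear_scale _ _ lT) innerZl; apply/esym/(etrans (sqr_normcE _)).
  by rewrite conjcK.
have uu : inner u u = (\sum_(x <- A) normc ((inner (T (delta x)) v)^*%C) ^+ 2)%:C.
  rewrite {1}/u inner_suml (rmorph_sum (real_complex R)) big_seq [RHS]big_seq;
    apply: eq_bigr => x xA.
  rewrite innerZl delta_inner; apply/esym/(etrans (sqr_normcE _)); congr (_ * _).
  apply/esym; congr (_^*%C).
  rewrite /u ell2_sumE (big_fsetD1 x)// ell2_scaleE deltaE eqxx mulr1.
  rewrite -[RHS]addr0; congr (_ + _).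
  rewrite big_seq big1// => y; rewrite !inE => /andP[yx _].
  by rewrite ell2_scaleE deltaE eq_sym (negPf yx) mulr0.
set s := \sum_(x <- A) _ in uE uu *.
have s0 : 0 <= s by apply: sumr_ge0 => x _; exact: sqr_ge0.
have us : ell2_norm u ^+ 2 = s by apply: complexI; rewrite -inner_norm.
have : s <= M * ell2_norm u.
  have := cauchy_schwarz (T u) v; rewrite uE normc_real ger0_norm// => /le_trans.
  apply; rewrite /M mulrAC ler_wpM2r ?ell2_norm_ge0//; exact: le_opnorm.
rewrite -us; have [->|u0] := eqVneq (ell2_norm u) 0.
  by rewrite expr0n sqr_ge0.
have nu0 : 0 < ell2_norm u by rewrite lt_neqAle eq_sym u0 ell2_norm_ge0.
rewrite expr2 ler_pM2r// => uM; rewrite -expr2 ler_sqr ?nnegrE ?ell2_norm_ge0//.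
exact: le_trans (ltW nu0) uM.
Qed.

(** The explicit coordinates of [adj_fun_l2] take the place of the Riesz theorem and exclude the
    default of [xget]; the adjoint identity holds on finite vectors and extends by truncation. *)
Lemma adj_spec T : bounded_op T ->
  bounded_op (adj T) /\ forall u v, inner (T u) v = inner u (adj T v).
Proof.
move=> bT; have [lT _] := bT; rewrite /adj; case: xgetP => [_ -> //|none].
exfalso; pose S v : ell2 R X := Ell2 (adj_fun_l2 v bT).
have SE u v : inner (T u) v = inner u (S v).
  apply/eqP; rewrite -subr_eq0; apply/eqP/normc_eq0_small => e e0.
  (* The sum of the constants in the two Cauchy-Schwarz bounds for the truncation error [w]; adding
     1 makes it positive. *)
  pose M := opnorm T * ell2_norm v + ell2_norm (S v) + 1.
  have M0 : 0 < M by rewrite ltr_wpDl// addr_ge0 ?mulr_ge0 ?opnorm_ge0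
    ?ell2_norm_ge0.
  have [G /(_ [set` G] (@subset_refl _ _))] := finite_approx u (divr_gt0 e0 M0).
  set w := u - _; rewrite ltr_pdivlMr// => /ltW; apply: le_trans.
  have iE : inner (T (indic_op [set` G] u)) v = inner (indic_op [set` G] u) (S v).
    rewrite indic_op_fset (linear_bigsum _ _ _ lT) !inner_suml;
      apply: eq_bigr => x _.
    rewrite (linear_scale _ _ lT) !innerZl delta_inner; congr (_ * _).
    exact/esym/conjcK.
  have wE : inner (T u) v - inner u (S v) = inner (T w) v - inner w (S v).
    by rewrite /w (linear_sub _ _ lT) !innerBl iE; ring.
  rewrite wE; apply: le_trans (le_normcD _ _) _; rewrite normcN.
  apply: le_trans (lerD (cauchy_schwarz _ _) (cauchy_schwarz _ _)) _.
  rewrite /M mulrDr mulr1 -[leLHS]addr0 lerD ?ell2_norm_ge0// mulrDr lerD//.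
  by rewrite mulrA ler_wpM2r ?ell2_norm_ge0// mulrC; exact: le_opnorm.
apply: (none S); split=> //; apply: (@bounded_op_bound _ _ (opnorm T)).
  move=> c v v'; apply: inner_injr => w.
  by rewrite -SE !innerDr !innerZr !SE.
move=> v; apply: ell2_norm_le_inner => [|u].
  by rewrite mulr_ge0 ?opnorm_ge0 ?ell2_norm_ge0.
rewrite -inner_conj normc_conj -SE; apply: le_trans (cauchy_schwarz _ _) _.
by rewrite mulrAC ler_wpM2r ?ell2_norm_ge0//; exact: le_opnorm.
Qed.

Lemma bounded_op_adj T : bounded_op T -> bounded_op (adj T).
Proof. by move=> /adj_spec[]. Qed.

Lemma inner_adjr T u v : bounded_op T -> inner (T u) v = inner u (adj T v).
Proof. by move=> /adj_spec[_]; apply. Qed.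

Lemma inner_adjl T u v : bounded_op T -> inner (adj T v) u = inner v (T u).
Proof. by move=> bT; rewrite -inner_conj -inner_adjr// inner_conj. Qed.

Lemma adj_unique T (S : ell2 R Y -> ell2 R X) : bounded_op T ->
  (forall u v, inner (T u) v = inner u (S v)) -> adj T = S.
Proof.
by move=> bT TS; apply/funext => v; apply: inner_injr => u; rewrite -inner_adjr.
Qed.

Lemma opnorm_adj_le T : bounded_op T -> opnorm (adj T) <= opnorm T.
Proof.
move=> bT; apply: opnorm_le => [|v]; first exact: opnorm_ge0.
apply: ell2_norm_le_inner => [|u].
  by rewrite mulr_ge0 ?opnorm_ge0 ?ell2_norm_ge0.
rewrite inner_adjl// -inner_conj normc_conj; apply: le_trans (cauchy_schwarz _ _) _.
by rewrite mulrAC ler_wpM2r ?ell2_norm_ge0//; exact: le_opnorm.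
Qed.

Lemma adj_sub S T : bounded_op S -> bounded_op T -> adj (S - T) = adj S - adj T.
Proof.
move=> bS bT; apply: adj_unique => [|u v]; first exact: bounded_op_sub.
by rewrite !op_subE innerBl innerBr (inner_adjr _ _ bS) (inner_adjr _ _ bT).
Qed.

End adjoint.

Lemma adjK {X Y : choiceType} (T : ell2 R X -> ell2 R Y) :
  bounded_op T -> adj (adj T) = T.
Proof.
move=> bT; apply: adj_unique => [|u v]; first exact: bounded_op_adj.
exact: inner_adjl.
Qed.

End bounded_operators.

(** * Uniform Roe algebras *)

Section weighted_partial_injection_operators.
Context {R : realType} {X Y : choiceType}.
Implicit Types (t : Y -> option X) (a : Y -> R[i]).

Lemma bounded_op_wpi t a (M : R) : partial_injection t ->
  (forall y, normc (a y) <= M) -> bounded_op (wpi t a).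
Proof.
move=> tinj aM; apply: (@bounded_op_bound _ _ _ `|M|) => [c u v|u].
  apply: ell2P => y; rewrite ell2_addE ell2_scaleE !(wpiE _ _ tinj aM).
  by case: (t y) => [x|]; rewrite ?mulr0 ?addr0// mulrDr mulrCA.
apply: ell2_norm_wpi => // y; apply: le_trans (aM y) (ler_norm _).
Qed.

Lemma wpi_delta t a (M : R) x y : partial_injection t ->
  (forall y, normc (a y) <= M) ->
  wpi t a (delta x) y = if t y == Some x then a y else 0 :> R[i].
Proof.
move=> tinj aM; rewrite (wpiE _ _ tinj aM); case: (t y) => [z|//].
rewrite deltaE (inj_eq Some_inj); case: (z == x); by rewrite ?mulr1 ?mulr0.
Qed.

End weighted_partial_injection_operators.

Section diagonal_operators_bounded.
Context {R : realType} {X : choiceType}.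
Implicit Types (a : X -> R[i]) (S : set X).

Lemma bounded_op_diag a (M : R) : (forall x, normc (a x) <= M) ->
  bounded_op (diag a).
Proof. by move=> aM; exact: (bounded_op_wpi (@partial_injection_Some X) aM). Qed.

Lemma diag_delta a (M : R) x y : (forall x, normc (a x) <= M) ->
  diag a (delta x) y = if y == x then a y else 0 :> R[i].
Proof.
by move=> aM; rewrite /diag (wpi_delta _ _ (@partial_injection_Some X) aM).
Qed.

Lemma bounded_op_indic S : bounded_op (indic_op S : op R X).
Proof. exact: bounded_op_diag (normc_indic_le1 S). Qed.

Lemma adj_indic S : adj (indic_op S) = indic_op S :> op R X.
Proof.
apply: adj_unique => [|u v]; first exact: bounded_op_indic.
apply/esym/inner_unique; rewrite (_ : (fun x => _) =
    (fun x => (indic_op S u x : R[i]) * (v x : R[i])^*%C : R[i]^o)).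
  exact: inner_cvg.
apply/funext => x; rewrite !indic_opE; case: ifP => //.
by rewrite conjc0 mulr0 mul0r.
Qed.

Lemma indic_op_comp S S' :
  indic_op S \o indic_op S' = indic_op (S `&` S') :> op R X.
Proof.
apply/funext => u; apply: ell2P => x; rewrite /= !indic_opE in_setI.
by case: (x \in S).
Qed.

End diagonal_operators_bounded.

Section support.
Context {R : realType} {X : choiceType}.
Implicit Types (S T : op R X).
Local Open Scope relation_scope.

Lemma suppE T x y : supp T (x, y) = (T (delta x) y != 0 :> R[i]).
Proof. by rewrite /supp /= inner_delta. Qed.

Lemma supp_eq0 T x y : ~ supp T (x, y) -> T (delta x) y = 0 :> R[i].
Proof. by rewrite suppE => /negP; rewrite negbK => /eqP. Qed.

Lemma bounded_op_coef S T : bounded_op S -> bounded_op T ->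
  (forall x y, S (delta x) y = T (delta x) y :> R[i]) -> S = T.
Proof.
by move=> bS bT ST; apply: bounded_op_ext => // x; apply: ell2P => y; exact: ST.
Qed.

(** The coefficient of [S \o T] at [(x, y)] is the sum over [z] of the products of the coefficients
    of [T] at [(x, z)] and of [S] at [(z, y)]. The composition of relations reads right to left,
    like that of operators. *)
Lemma supp_comp S T : bounded_op S -> supp (S \o T) `<=` supp S \; supp T.
Proof.
move=> bS [x y]; rewrite /supp /= => /eqP ST; apply: contrapT => none; apply: ST.
rewrite inner_adjr//; apply: inner_unique.
rewrite (_ : partial_sum _ = fun=> 0 : R[i]^o).
  exact: (@cvg_cst _ _ _ _ totally_filter).
apply/funext => A; rewrite partial_sumE big1// => z _.
rewrite -(inner_delta (T (delta x)) z) -delta_inner -inner_adjr//.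
have [->|Tz] := eqVneq (inner (T (delta x)) (delta z)) 0; first by rewrite mul0r.
have [->|Sz] := eqVneq (inner (S (delta z)) (delta y)) 0; first by rewrite mulr0.
by case: none; exists z.
Qed.

Lemma supp_adj T : bounded_op T -> supp (adj T) = (supp T)^-1.
Proof.
move=> bT; apply/seteqP; split=> -[x y]; rewrite /supp /= inner_adjl//.
  by rewrite -inner_conj conjc_eq0.
by rewrite -[in X in _ -> X]inner_conj conjc_eq0.
Qed.

Lemma supp_comb S T (c : R[i]) : supp (c *: S + T) `<=` supp S `|` supp T.
Proof.
move=> [x y]; rewrite /supp /= op_combE innerDl innerZl => ST.
have [S0|] := eqVneq (inner (S (delta x)) (delta y)) 0; last by left.
by right; move: ST; rewrite S0 mulr0 add0r.
Qed.

Lemma supp0 : supp (0 : op R X) = set0.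
Proof.
by apply/seteqP; split=> // -[x y]; rewrite /supp /= inner0l eqxx.
Qed.

Lemma normc_coef_le T x y : bounded_op T -> normc (T (delta x) y : R[i]) <=
  opnorm T.
Proof.
move=> bT; apply: le_trans (normc_le_norm _ _) _.
by have := le_opnorm (delta x) bT; rewrite norm_delta mulr1.
Qed.

End support.

Section norm_closure.
Context {R : realType} {X : choiceType}.
Implicit Types (A B : set (op R X)) (S T U : op R X).

Lemma compE {Y Z : choiceType} (S : ell2 R Y -> ell2 R Z)
  (T : ell2 R X -> ell2 R Y) (u : ell2 R X) : (S \o T) u = S (T u).
Proof. by []. Qed.

Lemma opnorm_triangle S T U : bounded_op S -> bounded_op T -> bounded_op U ->
  opnorm (S - U) <= opnorm (S - T) + opnorm (T - U).
Proof.
move=> bS bT bU.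
rewrite (_ : S - U = 1 *: (S - T) + (T - U)).
  apply: le_trans (opnorm_comb _ _ _) _; try exact: bounded_op_sub.
  by rewrite normc1 mul1r.
by rewrite scale1r addrA subrK.
Qed.

Lemma sub_norm_closure A : A `<=` bounded_op -> A `<=` norm_closure A.
Proof.
move=> Ab T AT; split=> [|e e0]; first exact: Ab.
by exists T => //; rewrite subrr opnorm0.
Qed.

Lemma norm_closure_idem A : A `<=` bounded_op ->
  norm_closure (norm_closure A) `<=` norm_closure A.
Proof.
move=> Ab T [bT h]; split=> // e e0.
have e20 : 0 < e / 2 by rewrite divr_gt0.
have [S [bS hS] TS] := h _ e20; have [U AU SU] := hS _ e20.
exists U => //; apply: le_lt_trans (opnorm_triangle bT bS (Ab _ AU)) _.
by rewrite (splitr e) ltrD.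
Qed.

Lemma star_algebra_norm_closure A : star_algebra A -> cstar_algebra
  (norm_closure A).
Proof.
move=> [[Ab A0] Acomb Acomp Aadj].
have clb : norm_closure A `<=` bounded_op by move=> T [].
split; last exact: norm_closure_idem.
split.
- by split=> //; exact: sub_norm_closure.
- move=> c S T [bS hS] [bT hT]; split=> [|e e0]; first exact: bounded_op_comb.
  have c0 : 0 < normc c + 1 by rewrite ltr_wpDl ?normc_ge0.
  have [S' AS' SS'] := hS (e / (normc c + 1) / 2) (divr_gt0 (divr_gt0 e0 c0)
    (ltr0Sn _ 1)).
  have [T' AT' TT'] := hT (e / 2) (divr_gt0 e0 (ltr0Sn _ 1)).
  exists (c *: S' + T'); first exact: Acomb.
  rewrite (_ : _ - _ = c *: (S - S') + (T - T')); last first.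
    by rewrite scalerBr opprD addrACA.
  have bSS' : bounded_op (S - S') by apply: bounded_op_sub => //; exact: Ab.
  have bTT' : bounded_op (T - T') by apply: bounded_op_sub => //; exact: Ab.
  apply: le_lt_trans (opnorm_comb c bSS' bTT') _.
  rewrite (splitr e) ler_ltD//.
  apply: le_trans (ler_wpM2l (normc_ge0 c) (ltW SS')) _.
  rewrite mulrA ler_wpM2r// mulrA ler_pdivrMr// mulrC ler_wpM2l ?ltW//.
  by rewrite ltrDl.
- move=> S T [bS hS] [bT hT]; split=> [|e e0]; first exact: bounded_op_comp.
  (* The product is approximated through [(S - S') T + S' (T - T')]: the tolerance for [T'] depends
     on the norm of [S'], which is therefore chosen before it. *)
  have T0 : 0 < opnorm T + 1 by rewrite ltr_wpDl ?opnorm_ge0.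
  have [S' AS' SS'] := hS (e / 2 / (opnorm T + 1)) (divr_gt0 (divr_gt0 e0
    (ltr0Sn _ 1)) T0).
  have S0 : 0 < opnorm S' + 1 by rewrite ltr_wpDl ?opnorm_ge0.
  have [T' AT' TT'] := hT (e / 2 / (opnorm S' + 1)) (divr_gt0 (divr_gt0 e0
    (ltr0Sn _ 1)) S0).
  have bS' := Ab _ AS'; have bT' := Ab _ AT'; have [lS' _] := bS'.
  exists (S' \o T'); first exact: Acomp.
  rewrite (_ : _ - _ = 1 *: ((S - S') \o T) + (S' \o (T - T'))); last first.
    rewrite scale1r; apply/funext => u.
    by rewrite op_subE op_addE !compE !op_subE (linear_sub _ _ lS') addrA subrK.
  have bSS' : bounded_op (S - S') by exact: bounded_op_sub.
  have bTT' : bounded_op (T - T') by exact: bounded_op_sub.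
  apply: le_lt_trans (opnorm_comb 1 (bounded_op_comp bSS' bT) (bounded_op_comp
    bS' bTT')) _.
  rewrite normc1 mul1r (splitr e) ltrD//.
    apply: le_lt_trans (opnorm_comp bSS' bT) _.
    move: SS'; rewrite ltr_pdivlMr//; apply: le_lt_trans.
    by rewrite ler_wpM2l ?opnorm_ge0// lerDl.
  apply: le_lt_trans (opnorm_comp bS' bTT') _.
  move: TT'; rewrite ltr_pdivlMr//; apply: le_lt_trans.
  by rewrite mulrC ler_wpM2l ?opnorm_ge0// lerDl.
- move=> S [bS hS]; split=> [|e e0]; first exact: bounded_op_adj.
  have [T AT ST] := hS e e0; exists (adj T); first exact: Aadj.
  have bT := Ab _ AT; rewrite -adj_sub//; apply: le_lt_trans ST.
  by apply: opnorm_adj_le; exact: bounded_op_sub.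
Qed.

Lemma star_algebra_add A S T : star_algebra A -> A S -> A T -> A (S + T).
Proof. by move=> [_ Acomb _ _] AS AT; rewrite -(scale1r S); exact: Acomb. Qed.

Lemma star_algebra_scale A (c : R[i]) S : star_algebra A -> A S -> A (c *: S).
Proof. by move=> [[_ A0] Acomb _ _] AS; rewrite -(addr0 (c *: S));
  exact: Acomb. Qed.

Lemma star_algebra_sum A (I : Type) (s : seq I) (P : pred I) (f : I -> op R X) :
  star_algebra A -> (forall i, P i -> A (f i)) -> A (\sum_(i <- s | P i) f i).
Proof.
move=> sA Af; elim/big_ind : _ => //; first by case: sA => -[].
by move=> S T AS AT; exact: star_algebra_add.
Qed.

End norm_closure.

Section uniform_roe_cstar.
Context {R : realType} {X : choiceType} (C : set (set (X * X))).
Hypothesis cC : coarse_structure C.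
Local Open Scope relation_scope.

Definition controlled : set (op R X) := [set T | bounded_op T /\ C (supp T)].

Lemma controlled_star_algebra : star_algebra controlled.
Proof.
have [Cd Cs Ci Cu Cc] := cC; split.
- split=> [T []//|]; split; first exact: bounded_op0.
  by apply: Cs Cd _; rewrite supp0.
- move=> c S T [bS CS] [bT CT]; split; first exact: bounded_op_comb.
  by apply: Cs (Cu _ _ CS CT) _; exact: supp_comb.
- move=> S T [bS CS] [bT CT]; split; first exact: bounded_op_comp.
  by apply: Cs (Cc _ _ CS CT) _; exact: supp_comp.
- move=> S [bS CS]; split; first exact: bounded_op_adj.
  by rewrite supp_adj//; exact: Ci.
Qed.

Lemma uniform_roe_cstar : cstar_algebra (uniform_roe C : set (op R X)).
Proof. exact/star_algebra_norm_closure/controlled_star_algebra. Qed.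

Lemma controlled_roe : controlled `<=` uniform_roe C.
Proof. by apply: sub_norm_closure => T []. Qed.

Lemma ell_infty_roe : (ell_infty : set (op R X)) `<=` uniform_roe C.
Proof.
move=> T [bT dT]; apply: controlled_roe; split=> //.
by have [Cd Cs _ _ _] := cC; exact: Cs dT.
Qed.

End uniform_roe_cstar.

(** * Bounded diagonal operators as a maximal abelian algebra *)

Section ell_infty_theory.
Context {R : realType} {X : choiceType}.
Implicit Types (S T : op R X).

(** For this coarse structure the controlled operators are exactly those of [ell_infty], whose
    algebra axioms thus become a special case. *)
Lemma diagonal_coarse : coarse_structure [set E : set (X * X) | E `<=` diagonal].
Proof.
split=> //=.
- by move=> E F Ed FE; exact: subset_trans Ed.
- by move=> E Ed [x y] /= /Ed; exact: esym.
- by move=> E F Ed Fd x [/Ed|/Fd].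
- by move=> E F Ed Fd [x y] [z /Fd + /Ed]; rewrite /diagonal/= => -> ->.
Qed.

Lemma ell_infty_star_algebra : star_algebra (ell_infty : set (op R X)).
Proof. exact: controlled_star_algebra diagonal_coarse. Qed.

Lemma ell_infty_cstar : cstar_algebra (ell_infty : set (op R X)).
Proof.
split=> [|T [bT h]]; first exact: ell_infty_star_algebra.
split=> // -[x y]; rewrite /diagonal suppE => Txy; apply: contrapT => /= xy.
move/eqP : Txy; apply; apply: normc_eq0_small => e /h[S [bS dS]] /ltW TS.
have S0 : S (delta x) y = 0 :> R[i] by apply: supp_eq0 => /dS.
apply: le_trans TS; have := normc_coef_le x y (bounded_op_sub bT bS).
by rewrite op_subE ell2_addE ell2_oppE S0 subr0.
Qed.

Lemma ell_infty_delta T x : ell_infty T ->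
  T (delta x) = (T (delta x) x : R[i]) *: delta x.
Proof.
move=> [bT dT]; apply: ell2P => y; rewrite ell2_scaleE deltaE.
have [->|yx] := eqVneq y x; first by rewrite mulr1.
by rewrite mulr0; apply: supp_eq0 => /dT; rewrite /diagonal/= => xy;
  rewrite xy eqxx in yx.
Qed.

Lemma ell_infty_abelian : abelian_algebra (ell_infty : set (op R X)).
Proof.
move=> S T iS iT; have [[bS _] [bT _]] := (iS, iT).
apply: bounded_op_ext; try exact: bounded_op_comp.
move=> x /=; move: (ell_infty_delta x iT) (ell_infty_delta x iS).
move: (T _ _ : R[i]) (S _ _ : R[i]) => a b Ta Sb.
rewrite Ta Sb (linear_scale _ _ bS.1) (linear_scale _ _ bT.1) Ta Sb.
by rewrite !scalerA mulrC.
Qed.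

Lemma diag_ell_infty (a : X -> R[i]) (M : R) : (forall x, normc (a x) <= M) ->
  ell_infty (diag a).
Proof.
move=> aM; split=> [|[x y]]; first exact: bounded_op_diag aM.
by rewrite suppE (diag_delta _ _ aM) /diagonal/=; case: (eqVneq y x) => // _;
  rewrite eqxx.
Qed.

Lemma indic_ell_infty (S : set X) : ell_infty (indic_op S : op R X).
Proof. exact: diag_ell_infty (normc_indic_le1 S). Qed.

(** Commuting with the indicator of the point [x] forces [T (delta x)] to be supported at [x].
    Maximality of [ell_infty] follows, as it contains all indicators. *)
Lemma commute_indic_ell_infty T : bounded_op T ->
  (forall S : set X, T \o indic_op S = indic_op S \o T) -> ell_infty T.
Proof.
move=> bT com; split=> // -[x y]; rewrite suppE /diagonal/= => Txy.
apply: contrapT => xy; move/eqP : Txy; apply.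
have := congr1 (fun W : op R X => W (delta x) y : R[i]) (com [set x]).
rewrite /= indic_opE memNset//=; last by move=> yx; exact/xy/esym.
move=> <-; congr (T _ y : R[i]); apply: ell2P => z.
by rewrite indic_opE deltaE; case: (eqVneq z x) => [->|zx];
  [rewrite mem_set|case: ifP].
Qed.

Lemma id_ell_infty : ell_infty (id : op R X).
Proof.
split=> [|[x y]]; first exact: bounded_op_id.
by rewrite suppE deltaE /diagonal/=; case: (eqVneq y x) => // _; rewrite eqxx.
Qed.

Lemma ell_infty_masa (A : set (op R X)) : A `<=` bounded_op ->
  ell_infty `<=` A -> masa A ell_infty.
Proof.
move=> Ab iA; split=> //; [exact: ell_infty_cstar|exact: ell_infty_abelian|].
move=> D sD abD DA iD; apply/seteqP; split=> // T DT.
apply: commute_indic_ell_infty => [|S]; first exact/Ab/DA.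
by apply: abD => //; apply: iD; exact: indic_ell_infty.
Qed.

End ell_infty_theory.

(** The constant net at the identity, over a one-point index set, serves. *)
Lemma approximate_unit_id (R : realType) (X : choiceType) (A B : set (op R X)) :
  A `<=` bounded_op -> B id -> approximate_unit_in A B.
Proof.
move=> Ab Bid; exists unit, (fun _ _ => True), (fun=> id); split.
- by split=> // _ _; exists tt.
- move=> _; split=> //; last by apply: opnorm_le => // u; rewrite mul1r.
  by split=> [|u]; [exact: bounded_op_id|exact: inner_ge0].
- move=> _ _ _; rewrite subrr; split=> [|u]; first exact: bounded_op0.
  by rewrite inner0l.
- move=> a r Aa r0; exists tt => _ _.
  have aa : a - a = 0 by exact: subrr.
  have a0 : opnorm (a - a) < r by rewrite aa opnorm0.
  by split.
Qed.

(** * The diagonal masa *)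

Lemma op_sumE (R : realType) (X Y : choiceType) (I : Type) (s : seq I) (P : pred I)
    (f : I -> ell2 R X -> ell2 R Y) (u : ell2 R X) :
  (\sum_(i <- s | P i) f i) u = \sum_(i <- s | P i) f i u.
Proof. by elim/big_ind2 : _ => // S v T w <- <-. Qed.

Lemma bounded_op_sum (R : realType) (X Y : choiceType) (I : Type) (s : seq I)
    (P : pred I) (f : I -> ell2 R X -> ell2 R Y) :
  (forall i, P i -> bounded_op (f i)) -> bounded_op (\sum_(i <- s | P i) f i).
Proof.
move=> bf; elim/big_ind : _ => //; first exact: bounded_op0.
by move=> S T bS bT; rewrite -(scale1r S); exact: bounded_op_comb.
Qed.

Lemma cvg_totally_sum (R : realType) (I : choiceType) (J : Type) (s : seq J)
    (f : J -> {fset I} -> R[i]^o) (l : J -> R[i]^o) :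
  (forall j, f j @ totally --> l j) ->
  (fun A => \sum_(j <- s) f j A) @ totally --> \sum_(j <- s) l j.
Proof.
move=> fl; elim: s => [|j s IHs].
  rewrite big_nil (_ : (fun=> _) = fun=> 0);
    first exact: (@cvg_cst _ _ _ _ totally_filter).
  by apply/funext => A; rewrite big_nil.
rewrite big_cons (_ : (fun=> _) = fun A => f j A + \sum_(j <- s) f j A).
  exact: (@cvgD _ _ _ _ (@totally_filter I) _ _ _ _ (fl j) IHs).
by apply/funext => A; rewrite big_cons.
Qed.

Section diagonal_expectation.
Context {R : realType} {X : choiceType}.
Implicit Types (S T : op R X) (u : ell2 R X).

Definition diag_part T : op R X := diag (fun x => T (delta x) x).

Lemma diag_partE T u x : bounded_op T ->
  diag_part T u x = (T (delta x) x : R[i]) * (u x : R[i]) :> R[i].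
Proof.
by move=> bT; rewrite /diag_part (diagE _ _ (fun y => normc_coef_le y y bT)).
Qed.

Lemma diag_part_ell_infty T : bounded_op T -> ell_infty (diag_part T).
Proof. by move=> bT; apply: (diag_ell_infty (fun y => normc_coef_le y y bT)). Qed.

Lemma bounded_op_diag_part T : bounded_op T -> bounded_op (diag_part T).
Proof. by move=> /diag_part_ell_infty[]. Qed.

Lemma diag_part_id T : ell_infty T -> diag_part T = T.
Proof.
move=> iT; have [bT _] := iT; apply: bounded_op_coef => [||x y]//.
  exact: bounded_op_diag_part.
rewrite diag_partE// [in RHS]ell_infty_delta// ell2_scaleE !deltaE.
by case: (eqVneq y x) => [->//|_]; rewrite !mulr0.
Qed.

Lemma ell_inftyE T u x : ell_infty T ->
  T u x = (T (delta x) x : R[i]) * (u x : R[i]) :> R[i].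
Proof.
by move=> iT; have [bT _] := iT; rewrite -{1}(diag_part_id iT) diag_partE.
Qed.

Lemma diag_part_comb (c : R[i]) S T : bounded_op S -> bounded_op T ->
  diag_part (c *: S + T) = c *: diag_part S + diag_part T.
Proof.
move=> bS bT; apply/funext => u; apply: ell2P => x.
rewrite (diag_partE _ _ (bounded_op_comb c bS bT)) !op_combE !ell2_addE
  !ell2_scaleE.
by rewrite !diag_partE// mulrDl mulrA.
Qed.

Lemma opnorm_diag_part T : bounded_op T -> opnorm (diag_part T) <= opnorm T.
Proof.
move=> bT; apply: opnorm_le => [|u]; first exact: opnorm_ge0.
apply: ell2_norm_wpi; [exact: partial_injection_Some|exact: opnorm_ge0|].
by move=> x; exact: normc_coef_le.
Qed.

Lemma diag_part_bimodule b T b' : ell_infty b -> bounded_op T -> ell_infty b' ->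
  diag_part (b \o T \o b') = b \o diag_part T \o b'.
Proof.
move=> ib bT ib'; have [[bb _] [bb' _]] := (ib, ib').
apply/funext => u; apply: ell2P => x.
rewrite (diag_partE _ _ (bounded_op_comp (bounded_op_comp bb bT) bb')).
rewrite -[(b \o T \o b') (delta x)]/(b (T (b' (delta x)))).
rewrite -[(b \o diag_part T \o b') u]/(b (diag_part T (b' u))).
have bE v : b v x = (b (delta x) x : R[i]) * (v x : R[i]) :> R[i] := ell_inftyE
  v x ib.
have b'x := ell_infty_delta x ib'; have b'E := ell_inftyE u x ib'.
move: (b (delta x) x : R[i]) (b' (delta x) x : R[i]) bE b'x b'E => p q bE b'x b'E.
rewrite !bE diag_partE// b'E b'x (linear_scale _ _ bT.1) ell2_scaleE.
by ring.
Qed.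

(** The diagonal entry of [adj T \o T] at [x] is the squared norm of [T (delta x)]. *)
Lemma diag_part_faithful T : bounded_op T -> diag_part (adj T \o T) = 0 -> T = 0.
Proof.
move=> bT d0; apply: bounded_op_ext => // [|x]; first exact: bounded_op0.
apply: inner_eq0; rewrite inner_adjr// -inner_conj.
have bTT := bounded_op_comp (bounded_op_adj bT) bT.
have := diag_partE (delta x) x bTT; rewrite d0 deltaE eqxx mulr1 => TT0.
by rewrite inner_delta -[adj T (T _)]/((adj T \o T) (delta x)) -TT0 conjc0.
Qed.

(** The form of the diagonal parts at [u] is the sum over [x] of the form of [a] at the vectors
    [u j x *: delta x]. Finite subsums are nonnegative by hypothesis, and so is their limit. *)
Lemma diag_part_positive n (a : 'I_n -> 'I_n -> op R X) :
  (forall i j, bounded_op (a i j)) -> positive_opmx a ->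
  positive_opmx (fun i j => diag_part (a i j)).
Proof.
move=> ba pa u; apply: ge0_complex_closed => e e0.
pose f i j x : R[i]^o := (diag_part (a i j) (u j) x : R[i]) * (u i x : R[i])^*%C.
have fcvg : (fun A => \sum_(i < n) \sum_(j < n) partial_sum (f i j) A) @ totally -->
   (\sum_(i < n) \sum_(j < n) inner (diag_part (a i j) (u j)) (u i) : R[i]^o).
  apply: cvg_totally_sum => i.
  apply: cvg_totally_sum => j; exact: inner_cvg.
have /cvg_totally_complexP/(_ e e0)[G GP] := fcvg.
eexists; last exact: (GP G (fsubset_refl _)).
rewrite (eq_bigr (fun i => \sum_(x <- G) \sum_(j < n) f i j x)); last first.
  move=> i _; rewrite [RHS]exchange_big; apply: eq_bigr => j _; exact: partial_sumE.
rewrite exchange_big; apply: sumr_ge0 => x _.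
have := pa (fun j => (u j x : R[i]) *: delta x).
rewrite (eq_bigr (fun i => \sum_(j < n) (f i j x : R[i])))// => i _.
apply: eq_bigr => j _; rewrite /f diag_partE// (linear_scale _ _ (ba i j).1).
by rewrite innerZl innerZr inner_delta; ring.
Qed.

Lemma diag_part_expectation (A : set (op R X)) : A `<=` bounded_op ->
  conditional_expectation A ell_infty diag_part /\ faithful A diag_part.
Proof.
move=> Ab; split; last by move=> a Aa; apply: diag_part_faithful; exact: Ab.
split.
- by move=> a /Ab; exact: diag_part_ell_infty.
- by move=> c a b /Ab ba /Ab bb; exact: diag_part_comb.
- split; first by move=> n a Aa; apply: diag_part_positive => i j; exact/Ab/Aa.
  by move=> a /Ab; exact: opnorm_diag_part.
- exact: diag_part_id.
- by move=> b a b' ib /Ab ba ib'; exact: diag_part_bimodule.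
Qed.

End diagonal_expectation.

(** * Generation of the Roe algebra by normalizers of the diagonal *)

Section normalizers.
Context {R : realType} {X : choiceType}.
Local Open Scope relation_scope.

(** An entry of [T \o b \o adj T] comes from a path that goes from [y] back along the support of [T]
    to some [x], stays there under the diagonal [b], and goes forward to [y']; as [x] has at most
    one successor, [y = y']. The other product is symmetric. *)
Lemma bijective_support_normalizer (A : set (op R X)) T : A T -> bounded_op T ->
  (forall x y y', supp T (x, y) -> supp T (x, y') -> y = y') ->
  (forall x x' y, supp T (x, y) -> supp T (x', y) -> x = x') ->
  normalizer A ell_infty T.
Proof.
move=> AT bT rinj linj; split=> // b [bb db]; have baT := bounded_op_adj bT.
split; split; try by apply: bounded_op_comp => //; exact: bounded_op_comp.
- move=> [y y'] /supp_comp -/(_ (bounded_op_comp bT bb))[x yx].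
  move=> /supp_comp -/(_ bT)[z /db xz zy]; rewrite /diagonal/= in xz zy *.
  by move: yx; rewrite supp_adj//= xz => yz; exact: rinj yz zy.
- move=> [x x'] /supp_comp -/(_ (bounded_op_comp baT bb))[y xy].
  move=> /supp_comp -/(_ baT)[z /db yz]; rewrite supp_adj//= /diagonal/= in yz *.
  by rewrite -yz => yx; exact: linj xy yx.
Qed.

Lemma card_le_nat_inj (T : Type) (S : set T) (n : nat) : (S #<= `I_n)%card ->
  exists2 f : T -> nat, forall x, S x -> (f x < n)%N &
    forall x y, S x -> S y -> f x = f y -> x = y.
Proof.
move=> /pcard_leP[f]; exists f => [x Sx|x y Sx Sy fxy].
  exact: (@funS _ _ S `I_n f x Sx).
by apply: (@inj _ _ _ f) => //; rewrite inE.
Qed.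

(* Colour the edge (x, y) of the support by the position of y among the
   neighbours of x and the position of x among the neighbours of y: the edges
   of one colour form a partial bijection. *)
Lemma controlled_sub_generated (C : set (set (X * X))) (D : set (op R X)) :
  coarse_structure C -> uniformly_locally_finite C ->
  star_algebra D -> normalizer (uniform_roe C) ell_infty `<=` D ->
  controlled C `<=` D.
Proof.
move=> cC ulf sD nD T [bT CT]; have [_ Cs Ci _ _] := cC.
have [n nP] := ulf _ CT; have [m mP] := ulf _ (Ci _ CT).
have /choice[g gP] : forall x, exists g : X -> nat,
    (forall y, supp T (x, y) -> (g y < n)%N) /\
    (forall y y', supp T (x, y) -> supp T (x, y') -> g y = g y' -> y = y').
  by move=> x; have [g g1 g2] := card_le_nat_inj (nP x); exists g.
have /choice[h hP] : forall y, exists h : X -> nat,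
    (forall x, supp T (x, y) -> (h x < m)%N) /\
    (forall x x', supp T (x, y) -> supp T (x', y) -> h x = h x' -> x = x').
  by move=> y; have [h h1 h2] := card_le_nat_inj (mP y); exists h.
pose P k l x y := [/\ supp T (x, y), g x y = k & h y x = l].
(* The source of the edge of colour [(k, l)] that ends at [y]: two such sources would have the same
   position among the neighbours of [y]. *)
pose t k l y := if pselect (exists x, P k l x y) is left e then Some (projT1
  (cid e))
  else None.
have tE k l x y : t k l y = Some x <-> P k l x y.
  rewrite /t; case: pselect => [e|ne]; last by split=> // Pxy; case: ne; exists x.
  case: cid => z /= Pz; split=> [[<-]//|[sxy gk hl]]; congr Some.
  case: Pz => szy _ hz; apply: (hP y).2 => //; by rewrite hz hl.
have tinj k l : partial_injection (t k l).
  move=> y y' x /tE[s1 g1 _] /tE[s2 g2 _]; apply: (gP x).2 => //; by rewrite g1 g2.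
pose a k l y : R[i] := if t k l y is Some x then T (delta x) y else 0.
have aM k l y : normc (a k l y) <= opnorm T.
  rewrite /a; case: (t k l y) => [x|]; first exact: normc_coef_le.
  by rewrite normc0 opnorm_ge0.
pose W k l : op R X := wpi (t k l) (a k l).
have bW k l : bounded_op (W k l) := bounded_op_wpi (tinj k l) (aM k l).
have WE k l x y : W k l (delta x) y =
    if t k l y == Some x then T (delta x) y : R[i] else 0 :> R[i].
  rewrite /W (wpi_delta _ _ (tinj k l) (aM k l)); case: eqP => // txy.
  by rewrite /a txy.
have Wsupp k l x y : supp (W k l) (x, y) -> P k l x y.
  rewrite suppE WE; case: (t k l y =P Some x) => [txy _|_];
    [exact: (tE _ _ _ _).1 txy|by rewrite eqxx].
have DW k l : D (W k l).
  apply: nD; apply: bijective_support_normalizer => //.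
  - apply: controlled_roe; split=> //; by apply: Cs CT _ => -[x y] /Wsupp[].
  - move=> x y y' /Wsupp[s1 g1 _] /Wsupp[s2 g2 _]; apply: (gP x).2 => //;
    by rewrite g1 g2.
  - move=> x x' y /Wsupp[s1 _ h1] /Wsupp[s2 _ h2]; apply: (hP y).2 => //;
    by rewrite h1 h2.
(* An edge [(x, y)] has exactly one colour, [(g x y, h y x)], so a single summand contributes to
   this coefficient. *)
have -> : T = \sum_(k < n) \sum_(l < m) W k l.
  apply: bounded_op_coef => // [|x y].
    by apply: bounded_op_sum => k _; exact: bounded_op_sum.
  rewrite op_sumE ell2_sumE (eq_bigr (fun k : 'I_n => \sum_(l < m)
      (if t k l y == Some x then T (delta x) y : R[i] else 0))); last first.
    by move=> k _; rewrite op_sumE ell2_sumE; apply: eq_bigr => l _; exact: WE.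
  have [Txy|nTxy] := pselect (supp T (x, y)); last first.
    by rewrite (supp_eq0 nTxy) big1// => k _; rewrite big1// => l _; case: ifP.
  rewrite (bigD1 (Ordinal ((gP x).1 _ Txy)))//= (bigD1 (Ordinal ((hP y).1 _
    Txy)))//=.
  have -> : t (g x y) (h y x) y == Some x by apply/eqP/tE.
  rewrite [X in _ + X + _]big1 ?addr0 => [|l]; last first.
    apply: contraNeq; case: (_ =P Some x) => [/tE[_ _ hl] _|_];
      last by rewrite eqxx.
    by apply/eqP/val_inj.
  rewrite big1 ?addr0// => k; apply: contraNeq => sk; apply/eqP/val_inj => /=.
  apply: contrapT => gk; move/eqP: sk; apply; rewrite big1// => l _.
  by case: eqP => // /tE[_ /esym].
by apply: star_algebra_sum => // k _; apply: star_algebra_sum.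
Qed.

(** For generation: the Roe algebra is itself a C*-algebra containing the normalizer, and any such
    algebra contains the controlled operators and, being closed, their closure. *)
Lemma ell_infty_cartan (C : set (set (X * X))) :
  coarse_structure C -> uniformly_locally_finite C ->
  cartan_masa (uniform_roe C) (ell_infty : set (op R X)).
Proof.
move=> cC ulf; have cA := @uniform_roe_cstar R _ _ cC.
have Ab : (uniform_roe C : set (op R X)) `<=` bounded_op by move=> T [].
split.
- by apply: ell_infty_masa => //; exact: ell_infty_roe.
- by apply: approximate_unit_id => //; exact: id_ell_infty.
- apply/seteqP; split; first by apply: smallest_sub => // T [].
  move=> T [bT AT] D [[sD cD] nD]; apply: cD; split=> // e /AT[S SC TS].
  by exists S => //; exact: (controlled_sub_generated cC ulf sD nD).
- have [? ?] := diag_part_expectation Ab; by exists diag_part.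
Qed.

End normalizers.

(** * Conjugation by a unitary *)

Section unitary_conjugation.
Context {R : realType}.

(** It maps operators on the target of [U] to operators on its source, inversely to Ad U, so that
    images under Ad U are written as preimages under [conj_op U], with no witness to carry. Ad U
    itself is [conj_op (adj U)]. *)
Definition conj_op {X Y : choiceType} (U : ell2 R X -> ell2 R Y) (S : op R Y) :
  op R X :=
  adj U \o S \o U.

Section basic.
Context {X Y : choiceType} (U : ell2 R X -> ell2 R Y).
Hypothesis uU : unitary_op U.
Implicit Types (S T : op R Y) (u : ell2 R X) (v : ell2 R Y).

Lemma unitary_bounded : bounded_op U. Proof. by case: uU. Qed.
Let bU := unitary_bounded.
Let bV := bounded_op_adj bU.

Lemma unitary_adjK u : adj U (U u) = u.
Proof. by case: uU => _ h _; exact: (congr1 (fun f => f u) h). Qed.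

Lemma unitaryK v : U (adj U v) = v.
Proof. by case: uU => _ _ h; exact: (congr1 (fun f => f v) h). Qed.

Lemma unitary_adj : unitary_op (adj U).
Proof. by case: uU => _ h1 h2; split=> //; rewrite adjK. Qed.

Lemma inner_unitary u u' : inner (U u) (U u') = inner u u'.
Proof. by rewrite inner_adjr// unitary_adjK. Qed.

Lemma norm_unitary u : ell2_norm (U u) = ell2_norm u.
Proof.
have := inner_norm (U u); rewrite inner_unitary inner_norm => /complexI/eqP.
by rewrite eqrXn2 ?ell2_norm_ge0// => /eqP.
Qed.

Lemma conj_opE S u : conj_op U S u = adj U (S (U u)).
Proof. by []. Qed.

Lemma conj_op_adjE (T : op R X) : conj_op (adj U) T = U \o T \o adj U.
Proof. by rewrite /conj_op adjK. Qed.

Lemma conj_opK S : conj_op (adj U) (conj_op U S) = S.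
Proof. by apply/funext => v; rewrite conj_op_adjE /= conj_opE !unitaryK. Qed.

Lemma conj_opVK (T : op R X) : conj_op U (conj_op (adj U) T) = T.
Proof. by apply/funext => u; rewrite conj_opE conj_op_adjE /= !unitary_adjK. Qed.

Lemma bounded_conj_op S : bounded_op S -> bounded_op (conj_op U S).
Proof. by move=> bS; apply: bounded_op_comp => //; exact: bounded_op_comp. Qed.

Lemma conj_op_comb (c : R[i]) S T :
  conj_op U (c *: S + T) = c *: conj_op U S + conj_op U T.
Proof.
by apply/funext => u; rewrite op_combE !conj_opE op_combE (linear_comb bV.1).
Qed.

Lemma conj_op0 : conj_op U 0 = 0.
Proof. by apply/funext => u; rewrite conj_opE (linear_zero bV.1). Qed.

Lemma conj_op_sub S T : conj_op U (S - T) = conj_op U S - conj_op U T.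
Proof.
by apply/funext => u; rewrite op_subE !conj_opE op_subE (linear_sub _ _ bV.1).
Qed.

Lemma conj_op_comp S T : conj_op U (S \o T) = conj_op U S \o conj_op U T.
Proof. by apply/funext => u; rewrite /= !conj_opE unitaryK. Qed.

Lemma conj_op_id : conj_op U id = id.
Proof. by apply/funext => u; rewrite conj_opE unitary_adjK. Qed.

Lemma inner_conj_op S u u' : inner (conj_op U S u) u' = inner (S (U u)) (U u').
Proof. by rewrite conj_opE inner_adjl. Qed.

Lemma adj_conj_op S : bounded_op S -> adj (conj_op U S) = conj_op U (adj S).
Proof.
move=> bS; apply: adj_unique => [|u u']; first exact: bounded_conj_op.
by rewrite inner_conj_op (inner_adjr _ _ bS) (inner_adjr _ _ bU).
Qed.

Lemma opnorm_conj_op S : bounded_op S -> opnorm (conj_op U S) <= opnorm S.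
Proof.
move=> bS; apply: opnorm_le => [|u]; first exact: opnorm_ge0.
rewrite conj_opE -norm_unitary unitaryK -(norm_unitary u); exact: le_opnorm.
Qed.

Lemma projection_conj_op S : projection_op S -> projection_op (conj_op U S).
Proof.
move=> [bS SS aS]; split; first exact: bounded_conj_op.
  by rewrite -conj_op_comp SS.
by rewrite adj_conj_op// aS.
Qed.

End basic.

Section transport.
Context {X Y : choiceType} (U : ell2 R X -> ell2 R Y).
Hypothesis uU : unitary_op U.

Lemma conj_op_preimage_star (A : set (op R X)) :
  star_algebra A -> star_algebra (conj_op U @^-1` A).
Proof.
move=> [[Ab A0] Acomb Acomp Aadj].
have Ab' : conj_op U @^-1` A `<=` bounded_op.
  move=> S /Ab bS; rewrite -(conj_opK uU S).
  by apply: bounded_conj_op => //; exact: unitary_adj.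
split.
- by split=> //=; rewrite /preimage/= conj_op0.
- by move=> c S T AS AT; rewrite /preimage/= conj_op_comb//; exact: Acomb.
- by move=> S T AS AT; rewrite /preimage/= conj_op_comp//; exact: Acomp.
- move=> S AS; have bS := Ab' _ AS.
  by rewrite /preimage/= -adj_conj_op//; exact: Aadj.
Qed.

Lemma conj_op_preimage_cstar (A : set (op R X)) :
  cstar_algebra A -> cstar_algebra (conj_op U @^-1` A).
Proof.
move=> [sA cA]; have sA' := conj_op_preimage_star sA.
split=> // T [bT hT]; apply: cA; split=> [|e /hT[S AS TS]].
  exact: bounded_conj_op.
exists (conj_op U S) => //; rewrite -conj_op_sub//; apply: le_lt_trans TS.
apply: opnorm_conj_op => //; apply: bounded_op_sub => //.
by have [[+ _] _ _ _] := sA'; apply.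
Qed.

End transport.

Section transport_cartan.
Context {X Y : choiceType} (U : ell2 R X -> ell2 R Y).
Hypothesis uU : unitary_op U.
Implicit Types (A B : set (op R X)).
Let V := adj U.
Let uV : unitary_op V := unitary_adj uU.
Let c := conj_op U.
Let d := conj_op V.

Lemma conj_op_preimage_abelian A :
  abelian_algebra A -> abelian_algebra (c @^-1` A).
Proof.
move=> cA S T AS AT; rewrite -(conj_opK uU (S \o T)) -(conj_opK uU (T \o S)).
by rewrite (conj_op_comp uU S T) (conj_op_comp uU T S) (cA _ _ AS AT).
Qed.

Lemma conj_op_preimage_masa A B : masa A B -> masa (c @^-1` A) (c @^-1` B).
Proof.
move=> [cB BA abB maxB]; split.
- exact: conj_op_preimage_cstar.
- by move=> S /BA.
- exact: conj_op_preimage_abelian.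
move=> D sD abD DA BD.
(* The competitor [D] is moved back to the space of [B], where maximality applies. *)
have DE : d @^-1` D = B.
  apply: maxB.
  - exact: (conj_op_preimage_star uV).
  - move=> S T DS DT; rewrite -(conj_opVK uU (S \o T)) -(conj_opVK uU (T \o S)).
    by rewrite (conj_op_comp uV S T) (conj_op_comp uV T S) (abD _ _ DS DT).
  - by move=> T /DA; rewrite /preimage/= /c /d conj_opVK.
  - by move=> T BT; apply: BD; rewrite /preimage/= /c /d conj_opVK.
apply/seteqP; split=> [S DS|S].
  by rewrite /preimage/= -DE /preimage/= /c /d conj_opK.
by rewrite /preimage/= -DE /preimage/= /c /d conj_opK.
Qed.

Lemma conj_op_normalizer A B T : A `<=` bounded_op -> normalizer A B T ->
  normalizer (c @^-1` A) (c @^-1` B) (d T).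
Proof.
move=> Ab [AT nT]; have bT := Ab _ AT; split;
  first by rewrite /preimage/= /c /d conj_opVK.
move=> b /nT[n1 n2].
have bdT : bounded_op (d T) by exact: bounded_conj_op.
have adT : adj (d T) = d (adj T) by exact: adj_conj_op.
have cdE S : c (d S) = S by exact: conj_opVK.
have cE S S' : c (S \o S') = c S \o c S' by exact: conj_op_comp.
split; rewrite /preimage/= adT.
  by rewrite (cE (d T \o b) (d (adj T))) (cE (d T) b) !cdE.
by rewrite (cE (d (adj T) \o b) (d T)) (cE (d (adj T)) b) !cdE.
Qed.

(** The clauses are carried over by the mutually inverse [c] and [d], with [fun S => d (E (c S))] as
    expectation; the approximate unit is rebuilt from the identity, which [B] contains. *)
Lemma conj_op_preimage_cartan A B : cstar_algebra A -> B id -> cartan_masa A B ->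
  cartan_masa (c @^-1` A) (c @^-1` B).
Proof.
move=> cA Bid [mAB _ genA [E [EB Elin [Ecp Enorm] Eid Ebim] Ef]].
have cA' := conj_op_preimage_cstar uU cA.
have Ab : A `<=` bounded_op by have [[[]]] := cA.
have Ab' : c @^-1` A `<=` bounded_op by have [[[]]] := cA'.
split.
- exact: conj_op_preimage_masa.
- by apply: approximate_unit_id => //; rewrite /preimage/= /c conj_op_id.
- apply/seteqP; split; first by apply: smallest_sub => // T [].
  move=> S AS D [cD nD]; rewrite -(conj_opK uU S).
  have : (smallest cstar_algebra (normalizer A B)) (c S) by rewrite genA.
  (* The preimage of [D] under [d] is a C*-algebra containing the normalizer of [B] in [A], hence
     all of [A]. *)
  move=> /(_ (d @^-1` D)); apply; split; first exact: (conj_op_preimage_cstar uV).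
  by move=> T nT; apply: nD; exact: conj_op_normalizer.
have cdE T : c (d T) = T by exact: conj_opVK.
have dcE S : d (c S) = S by exact: conj_opK.
exists (fun S => d (E (c S))); last first.
  move=> S AS dE0; rewrite -(dcE S) (_ : c S = 0); first exact: conj_op0.
  apply: Ef => //; have bS := Ab' _ AS.
  by rewrite /c adj_conj_op// -(conj_op_comp uU (adj S) S) -[E _]cdE dE0 /c
    conj_op0.
split.
- by move=> S /EB; rewrite /preimage/= cdE.
- move=> k S T AS AT; rewrite -conj_op_comb// -Elin//; congr (d (E _)).
  exact: conj_op_comb.
- split=> [n a Aa pa u|S AS].
    have := Ecp n (fun i j => c (a i j)) Aa _ (fun i => adj U (u i)).
    rewrite (eq_bigr (fun i : 'I_n => \sum_(j < n)
        inner (d (E (c (a i j))) (u j)) (u i))).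
      apply=> v; have := pa (fun i => U (v i)).
      rewrite (eq_bigr (fun i : 'I_n => \sum_(j < n)
        inner (c (a i j) (v j)) (v i)))// => i _; apply: eq_bigr => j _.
      by rewrite /c inner_conj_op.
    by move=> i _; apply: eq_bigr => j _; rewrite /d inner_conj_op.
  apply: le_trans (opnorm_conj_op uV _) _; first by apply: Ab;
    have [_ + _ _] := mAB; apply; exact: EB.
  by apply: le_trans (Enorm _ AS) _; apply: opnorm_conj_op => //; exact: Ab'.
- by move=> b Bb; rewrite Eid.
- move=> b a b' Bb Aa Bb'.
  have -> : c (b \o a \o b') = c b \o c a \o c b'.
    by rewrite -(conj_op_comp uU b a) -(conj_op_comp uU (b \o a) b').
  rewrite Ebim// /d (conj_op_comp uV (c b \o E (c a)) (c b')).
  by rewrite (conj_op_comp uV (c b) (E (c a))) -/d !dcE.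
Qed.

End transport_cartan.
End unitary_conjugation.

(** * Spatial implementation of isomorphisms *)

Section rank_one_operators.
Context {R : realType} {X : choiceType}.
Implicit Types (u v w : ell2 R X) (S T : op R X).

Definition rank1 u v : op R X := fun w => inner w v *: u.

Lemma rank1_norm_le u v w : ell2_norm (rank1 u v w) <= ell2_norm u * ell2_norm
  v * ell2_norm w.
Proof.
rewrite /rank1 ell2_normZ -mulrA mulrC ler_wpM2l ?ell2_norm_ge0// mulrC.
exact: cauchy_schwarz.
Qed.

Lemma bounded_op_rank1 u v : bounded_op (rank1 u v).
Proof.
apply: bounded_op_bound (rank1_norm_le u v) => c w w'.
by rewrite /rank1 innerDl innerZl scalerDl scalerA.
Qed.

Lemma opnorm_rank1 u v : opnorm (rank1 u v) <= ell2_norm u * ell2_norm v.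
Proof.
by apply: opnorm_le (rank1_norm_le u v); rewrite mulr_ge0 ?ell2_norm_ge0.
Qed.

Lemma adj_rank1 u v : adj (rank1 u v) = rank1 v u.
Proof.
apply: adj_unique => [|w w']; first exact: bounded_op_rank1.
by rewrite /rank1 innerZl innerZr inner_conj mulrC.
Qed.

Lemma comp_rank1 T u v : linear T -> T \o rank1 u v = rank1 (T u) v.
Proof.
by move=> lT; apply/funext => w; rewrite /= /rank1 (linear_scale _ _ lT).
Qed.

Lemma rank1_comp T u v : bounded_op T -> rank1 u v \o T = rank1 u (adj T v).
Proof. by move=> bT; apply/funext => w; rewrite /= /rank1 (inner_adjr _ _ bT). Qed.

Lemma rank1_combl (c : R[i]) u u' v :
  rank1 (c *: u + u') v = c *: rank1 u v + rank1 u' v.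
Proof.
by apply/funext => w; rewrite op_combE /rank1 scalerDr !scalerA mulrC.
Qed.

(** The norm of [rank1 u v] is at most the product of the norms, so truncating [v], and then [u], to
    finite sums of basis vectors approximates it inside [A]. *)
Lemma rank1_mem (A : set (op R X)) u v : cstar_algebra A ->
  (forall x y, A (rank1 (delta x) (delta y))) -> A (rank1 u v).
Proof.
move=> [sA cA] Ad.
have fin_approx (w : ell2 R X) (M e : R) : 0 <= M -> 0 < e -> exists G : {fset X},
    ell2_norm (w - \sum_(x <- G) (w x : R[i]) *: delta x) * M < e.
  move=> M0 e0; have M1 : 0 < M + 1 by rewrite ltr_wpDl.
  have [G /(_ [set` G] (@subset_refl _ _))] := finite_approx w (divr_gt0 e0 M1).
  rewrite indic_op_fset ltr_pdivlMr// => lt; exists G; apply: le_lt_trans lt.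
  by rewrite ler_wpM2l ?ell2_norm_ge0// lerDl.
have Adv x : A (rank1 (delta x) v).
  apply: cA; split=> [|e e0]; first exact: bounded_op_rank1.
  have [G lt] := fin_approx v 1 e ler01 e0.
  set v' := \sum_(x <- G) _ in lt.
  exists (rank1 (delta x) v').
    rewrite (_ : rank1 _ v' = \sum_(y <- G) (v y : R[i])^*%C *: rank1 (delta x)
      (delta y)).
      by apply: star_algebra_sum => // y _; exact: star_algebra_scale.
    apply/funext => w; rewrite op_sumE /rank1 /v' inner_sumr scaler_suml.
    by apply: eq_bigr => y _; rewrite innerZr -scalerA.
  rewrite (_ : _ - _ = rank1 (delta x) (v - v')).
    by apply: le_lt_trans (opnorm_rank1 _ _) _; rewrite norm_delta mulrC.
  by apply/funext => w; rewrite op_subE /rank1 innerBr scalerBl.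
apply: cA; split=> [|e e0]; first exact: bounded_op_rank1.
have [G lt] := fin_approx u (ell2_norm v) e (ell2_norm_ge0 v) e0.
set u' := \sum_(x <- G) _ in lt.
exists (rank1 u' v).
  rewrite (_ : rank1 u' v = \sum_(x <- G) (u x : R[i]) *: rank1 (delta x) v).
    by apply: star_algebra_sum => // x _; exact: star_algebra_scale.
  apply/funext => w; rewrite op_sumE /rank1 /u' scaler_sumr.
  by apply: eq_bigr => x _; rewrite scalerA mulrC -scalerA.
rewrite (_ : _ - _ = rank1 (u - u') v).
  exact: le_lt_trans (opnorm_rank1 _ _) lt.
by apply/funext => w; rewrite op_subE /rank1 scalerBr.
Qed.

Lemma rank1_delta_roe (C : set (set (X * X))) x y : C [set (y, x)] ->
  coarse_structure C -> uniform_roe C (rank1 (delta x) (delta y) : op R X).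
Proof.
move=> Cyx cC; apply: controlled_roe; split; first exact: bounded_op_rank1.
have [_ Cs _ _ _] := cC; apply: Cs Cyx _ => -[p q].
rewrite suppE /rank1 ell2_scaleE inner_delta !deltaE.
case: (eqVneq y p) => [<-|]; last by rewrite mul0r eqxx.
by case: (eqVneq q x) => [->//|]; rewrite mulr0 eqxx.
Qed.

End rank_one_operators.

Section spatial_implementation.
Context {R : realType} {X Y : choiceType} (A : set (op R X)) (B : set (op R Y)).
Variable Phi : op R X -> op R Y.
Hypotheses (cA : cstar_algebra A) (cB : cstar_algebra B).
Hypothesis Adelta : forall x y, A (rank1 (delta x) (delta y)).
Hypothesis Bdelta : forall x y, B (rank1 (delta x) (delta y)).
Hypothesis isoPhi : star_isomorphism A B Phi.
Variable x0 : X.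

Let Ab : A `<=` bounded_op. Proof. by case: cA => -[[]]. Qed.
Let Bb : B `<=` bounded_op. Proof. by case: cB => -[[]]. Qed.
Let A0 : A 0. Proof. by case: cA => -[[]]. Qed.
Let Arank1 u v : A (rank1 u v). Proof. exact: rank1_mem. Qed.
Let Brank1 u v : B (rank1 u v). Proof. exact: rank1_mem. Qed.
Let Phi_comb (c : R[i]) S T : A S -> A T -> Phi (c *: S + T) = c *: Phi S + Phi T.
Proof. by case: isoPhi => _ h _ _; exact: h. Qed.
Let Phi_comp S T : A S -> A T -> Phi (S \o T) = Phi S \o Phi T.
Proof. by case: isoPhi => _ _ h _; exact: h. Qed.
Let Phi_adj S : A S -> Phi (adj S) = adj (Phi S).
Proof. by case: isoPhi => _ _ _ h; exact: h. Qed.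
Let Phi_mem S : A S -> B (Phi S).
Proof. by case: isoPhi => -[h _ _] _ _ _; exact: h. Qed.
Let Phi_surj b : B b -> exists2 a, A a & Phi a = b.
Proof. by case: isoPhi => -[_ _ h] _ _ _; exact: h. Qed.
Let Phi_inj S T : A S -> A T -> Phi S = Phi T -> S = T.
Proof. by case: isoPhi => -[_ h _] _ _ _ AS AT; apply: h; rewrite inE. Qed.
Let Phi0 : Phi 0 = 0.
Proof.
have := Phi_comb 1 A0 A0; rewrite !scale1r addr0 => h.
by apply/eqP; rewrite -(inj_eq (addrI (Phi 0))) -h addr0.
Qed.
Let PhiZ (c : R[i]) S : A S -> Phi (c *: S) = c *: Phi S.
Proof. by move=> AS; rewrite -(addr0 (c *: S)) Phi_comb// Phi0 addr0. Qed.

Let e := rank1 (delta x0) (delta x0) : op R X.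
Let p := Phi e.
Let Ae : A e. Proof. exact: Arank1. Qed.
Let bp : bounded_op p. Proof. exact/Bb/Phi_mem. Qed.

Let rank1_delta_comp (u v w w' : ell2 R X) :
  rank1 u v \o rank1 w w' = inner w v *: rank1 u w'.
Proof.
apply/funext => z; rewrite /= /rank1 innerZl [RHS]scalerA.
by rewrite mulrC.
Qed.

Let inner_d0 : inner (delta x0) (delta x0) = 1 :> R[i].
Proof. by rewrite inner_delta deltaE eqxx. Qed.

Let pp : p \o p = p.
Proof. by rewrite -Phi_comp// /e rank1_delta_comp inner_d0 scale1r. Qed.

Let p_adj : adj p = p.
Proof. by rewrite -Phi_adj// /e adj_rank1. Qed.

Let p_neq0 : p <> 0.
Proof.
rewrite -Phi0 => /(Phi_inj Ae A0) e0.
have : e (delta x0) = delta x0 by rewrite /e /rank1 inner_d0 scale1r.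
rewrite e0 => d0; have := norm_delta (R := R) x0; rewrite -d0 ell2_norm0.
by move/eqP; rewrite eq_sym oner_eq0.
Qed.

(** In [A], compressing [a] by the projection [e] gives the diagonal entry of [a] at [x0] times [e];
    [Phi] transports this identity and reaches every [b]. *)
Let p_minimal b : B b -> exists c : R[i], p \o b \o p = c *: p.
Proof.
move=> /Phi_surj[a Aa <-]; exists (inner (a (delta x0)) (delta x0)).
have Aea : A (e \o a) by case: cA => -[_ _ h _] _; exact: h.
rewrite -(Phi_comp Ae Aa) -(Phi_comp Aea Ae) -PhiZ//; congr Phi.
have [la _] := Ab Aa.
rewrite -[e \o a \o e]/(e \o (a \o e)) {2}/e comp_rank1//.
by rewrite /e rank1_delta_comp.
Qed.

(* For some y, the rank one operator p |delta_y><delta_y| p is nonzero; by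
   minimality it is a multiple of p. *)
Let p_rank1 : exists2 xi, p = rank1 xi xi & inner xi xi = 1.
Proof.
have [y py] : exists y, p (delta y) <> 0.
  apply: contrapT => none; apply: p_neq0; apply: bounded_op_ext => // [|y].
    exact: bounded_op0.
  by apply: contrapT => py; apply: none; exists y.
pose z := p (delta y).
have pz : p z = z by exact: (congr1 (fun f : op R Y => f (delta y)) pp).
have [c cP] := p_minimal (Brank1 (delta y) (delta y)).
have zP w : inner w z *: z = c *: p w.
  have := congr1 (fun f : op R Y => f w) cP.
  rewrite comp_rank1; last by case: bp.
  by rewrite rank1_comp// p_adj.
have nz : ell2_norm z != 0 by apply/eqP => /ell2_norm0_eq0.
have nz2 : inner z z != 0.
  by apply/eqP => /inner_eq0.
(* Evaluating [zP] at [z], which [p] fixes, identifies the scalar: [p] projects onto the line of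
   [z], and [xi] is [z] normalized by [r]. *)
have cE : c = inner z z.
  have := zP z; rewrite pz => /eqP; rewrite -subr_eq0 -scalerBl scaler_eq0.
  by case: (eqVneq z 0) => [z0|_]; [case: py|rewrite orbF subr_eq0 => /eqP].
pose r : R[i] := (ell2_norm z)^-1%:C.
have rr : r * r^*%C * inner z z = 1.
  rewrite /r conjc_real inner_norm -!rmorphM /= -(rmorph1 (real_complex R)).
  by congr (_%:C); field.
exists (r *: z); last by rewrite innerZl innerZr mulrA.
apply/funext => w; rewrite /rank1 innerZr scalerA mulrAC -scalerA zP cE scalerA.
by rewrite (mulrC r^*%C) rr scale1r.
Qed.

Lemma spatial_implementation : exists2 U : ell2 R X -> ell2 R Y, unitary_op U &
  forall T, A T -> Phi T = U \o T \o adj U.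
Proof.
have [xi pE xi1] := p_rank1.
have pxi : p xi = xi by rewrite pE /rank1 xi1 scale1r.
pose U u := Phi (rank1 u (delta x0)) xi.
have lU : linear U by move=> c u v; rewrite /U rank1_combl Phi_comb.
have iU u v : inner (U u) (U v) = inner u v.
  (* Multiplicativity on [rank1 (delta x0) u \o rank1 v (delta x0) = inner v u *: e], evaluated at
     [xi]; it makes [U] isometric. *)
  have key : Phi (rank1 (delta x0) u) (U v) = inner v u *: xi.
    have := congr1 (fun S : op R Y => S xi)
      (Phi_comp (Arank1 (delta x0) u) (Arank1 v (delta x0))).
    rewrite rank1_delta_comp PhiZ// -/e -/p => h; apply/esym.
    by rewrite -{1}pxi; exact: h.
  rewrite {1}/U inner_adjr; last exact/Bb/Phi_mem.
  by rewrite -Phi_adj// adj_rank1 key innerZr xi1 mulr1 inner_conj.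
have nU u : ell2_norm (U u) = ell2_norm u.
  have := inner_norm (U u); rewrite iU inner_norm => /complexI/eqP.
  by rewrite eqrXn2 ?ell2_norm_ge0// => /eqP.
have bU : bounded_op U.
  by apply: (@bounded_op_bound _ _ _ 1) => // u; rewrite nU mul1r.
have VU u : adj U (U u) = u.
  by apply: inner_inj => v; rewrite inner_adjl.
(* Since [T \o rank1 u v = rank1 (T u) v], multiplicativity of [Phi] becomes an intertwining
   relation. *)
have UT T u : A T -> U (T u) = Phi T (U u).
  by move=> AT; have [lT _] := Ab AT; rewrite /U -comp_rank1// Phi_comp.
(* Surjectivity: if [Phi a = rank1 w xi], then [U (a (delta x0)) = Phi a xi = w], as
   [U (delta x0) = xi]. *)
have UV w : U (adj U w) = w.
  have [a Aa aE] := Phi_surj (Brank1 w xi).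
  suff -> : w = U (a (delta x0)) by rewrite VU.
  rewrite UT//; rewrite /U -/e -/p pxi aE /rank1 xi1 scale1r//.
exists U.
  by split=> //; apply/funext => u /=.
by move=> T AT; apply/funext => w /=; rewrite UT// UV.
Qed.

End spatial_implementation.

(** * Ghost projections *)

Section ghost_projections.
Context {R : realType} {X Y : choiceType} (U : ell2 R X -> ell2 R Y).
Hypothesis uU : unitary_op U.

Let bU : bounded_op U := unitary_bounded uU.
Let V := adj U.
Let uV : unitary_op V := unitary_adj uU.

(** As [V] is the adjoint of [U], this is U 1_S U^*, the projection onto the closed span of the
    vectors [U (delta x)] with [x] in [S]. *)
Definition range_proj (S : set X) : op R Y := conj_op V (indic_op S).

Lemma range_projE S v : range_proj S v = U (indic_op S (V v)).
Proof. by rewrite /range_proj conj_op_adjE. Qed.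

Lemma projection_range_proj S : projection_op (range_proj S).
Proof.
apply: (projection_conj_op uV); split; first exact: bounded_op_indic.
  by rewrite indic_op_comp setIid.
exact: adj_indic.
Qed.

Lemma range_proj_delta S x : S x -> range_proj S (U (delta x)) = U (delta x).
Proof.
move=> Sx; rewrite range_projE /V unitary_adjK//; congr U; apply: ell2P => y.
rewrite indic_opE deltaE; case: (eqVneq y x) => [->|_]; first by rewrite mem_set.
by case: ifP.
Qed.

Lemma range_proj_orthogonal S S' : S `&` S' = set0 ->
  range_proj S \o range_proj S' = 0.
Proof.
move=> SS'; rewrite /range_proj -(conj_op_comp uV (indic_op S) (indic_op S')).
rewrite indic_op_comp SS' (_ : indic_op set0 = 0) ?conj_op0//.
by apply/funext => u; apply: ell2P => x; rewrite indic_opE in_set0.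
Qed.

Lemma norm_delta_sub x y : x != y ->
  ell2_norm (U (delta x) - U (delta y)) ^+ 2 = 2.
Proof.
move=> xy; apply: (@complexI R);
  rewrite -inner_norm innerBl !innerBr !inner_unitary//.
rewrite !inner_delta !deltaE !eqxx (negPf xy) eq_sym (negPf xy).
by rewrite subr0 sub0r opprK rmorph_nat.
Qed.

(** The image of the unit ball contains the vectors [U (delta (b n))], which are orthonormal and
    hence have no cluster point. *)
Lemma range_proj_noncompact S (b : nat -> X) : injective b -> (forall n, S (b n)) ->
  ~ compact_op (range_proj S).
Proof.
move=> binj Sb [_]; rewrite precompactE => cK.
pose v n := U (delta (b n)).
have vK n : closure (range_proj S @` [set u | ell2_norm u <= 1]) (v n).
  apply: subset_closure; exists (v n) => /=.
    by rewrite norm_unitary// norm_delta.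
  exact: range_proj_delta.
have hK : (v @ \oo) (closure (range_proj S @` [set u | ell2_norm u <= 1])).
  by exists 0%N => // n _; exact: vK.
have [p [_ pv]] := cK (v @ \oo) _ hK.
(* Two vectors in a ball of radius 1/2 are less than 1 apart, while distinct [v i] have squared
   distance 2. *)
pose N := ball p (2^-1%:C : R[i]).
have nN : nbhs p N by apply: nbhsx_ballx; rewrite ltcR invr_gt0.
have tail n : (v @ \oo) [set v k | k in [set k | (n <= k)%N]].
  by exists n => // k /= nk; exists k.
have [_ [[i _ <-] Ni]] := pv _ N (tail 0%N) nN.
have [_ [[j /= ij <-] Nj]] := pv _ N (tail i.+1) nN.
have : ell2_norm (v i - v j) ^+ 2 = 2.
  by apply: norm_delta_sub; rewrite (inj_eq binj) ltn_eqF.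
have close k : N (v k) -> ell2_norm (p - v k) < 2^-1.
  by rewrite /N -ball_normE /= ltcR.
have : ell2_norm (v i - v j) < 1.
  rewrite (_ : v i - v j = - (p - v i) + (p - v j));
    last by rewrite opprB addrA subrK.
  apply: le_lt_trans (ler_ell2_normD _ _) _; rewrite ell2_normN.
  by have := close _ Ni; have := close _ Nj; lra.
have := ell2_norm_ge0 (v i - v j); nra.
Qed.

Lemma normc_adj_coef x y : normc (V (delta y) x : R[i]) = normc (U (delta x) y
  : R[i]).
Proof.
by rewrite -[in LHS]inner_delta /V inner_adjl// -inner_conj normc_conj inner_delta.
Qed.

Lemma vanish_at_infinity (u : ell2 R Y) (e : R) : 0 < e ->
  exists G : {fset Y}, forall y, y \notin G -> normc (u y : R[i]) < e.
Proof.
move=> e0; have [G /(_ [set` G] (@subset_refl _ _)) lt] := finite_approx u e0.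
exists G => y yG; apply: le_lt_trans lt.
apply: le_trans (normc_le_norm _ y); rewrite ell2_addE ell2_oppE indic_opE.
by rewrite memNset ?subr0//=; exact/negP.
Qed.

(** Off a finite [G], the summable [w] bounds the sum uniformly in [y]; on [G], finitely many square
    summable functions of [y] vanish at infinity. Each part gets half of [e ^ 2]. *)
Lemma range_proj_vanish (S : set X) (w : X -> R) (e : R) :
  (forall x y, normc (U (delta x) y : R[i]) ^+ 2 <= w x) ->
  (\esum_(x in S) (w x)%:E < +oo)%E -> 0 < e ->
  exists F : {fset Y}, forall y, y \notin F -> ell2_norm (indic_op S (V (delta
    y))) < e.
Proof.
move=> Uw wS e0.
have w0 x y : 0 <= normc (U (delta x) y : R[i]) ^+ 2 := sqr_ge0 _.
(* [Uw] gives this as soon as [Y] has a point, and it has one because [U (delta x)] has norm 1. *)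
have wge0 x : 0 <= w x.
  have [[y _]|ny] := pselect (exists y : Y, True); first exact: le_trans (Uw x y).
  exfalso; have : ell2_norm (U (delta x)) = 1 by rewrite norm_unitary// norm_delta.
  have -> : U (delta x) = 0 by apply: ell2P => y; case: ny; exists y.
  by move/eqP; rewrite ell2_norm0 eq_sym oner_eq0.
have e2 : 0 < e ^+ 2 / 2 by rewrite divr_gt0// exprn_gt0.
have [G Ge] := esum_tail wge0 wS e2.
(* A divisor below, hence the added 1 in case [G] is empty. *)
pose N : R := #|` G|%:R + 1.
have N0 : 0 < N by rewrite ltr_wpDl.
have /choice[H HP] : forall x, exists H : {fset Y}, forall y, y \notin H ->
    normc (U (delta x) y : R[i]) < Num.sqrt (e ^+ 2 / 2 / N).
  by move=> x; apply: vanish_at_infinity; rewrite sqrtr_gt0 divr_gt0.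
exists (\bigcup_(x <- G) H x)%fset => y yF.
rewrite -ltr_sqr ?nnegrE ?ell2_norm_ge0 ?(ltW e0)// -lte_fin sqr_norm_indic_op.
under eq_esum do rewrite normc_adj_coef.
rewrite (esumID [set` G]); last by move=> x _; rewrite lee_fin.
have Gle : (\esum_(x in S `&` [set` G]) (normc (U (delta x) y : R[i]) ^+ 2)%:E <=
    (e ^+ 2 / 2)%:E)%E.
  apply: (@esum_le_fset R X) => A AG; rewrite lee_fin.
  have AG' : (A `<=` G)%fset by apply/fsubsetP => x /AG[].
  apply: (@le_trans _ _ (\sum_(x <- A) (e ^+ 2 / 2 / N))).
    rewrite big_seq [leRHS]big_seq; apply: ler_sum => x xA.
    have : y \notin H x.
      apply: contra yF => yH; apply/bigfcupP; exists x => //.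
      by rewrite andbT; exact: (fsubsetP AG').
    move=> /(HP x y)/ltW h; rewrite -[leRHS]sqr_sqrtr;
      last by rewrite ltW// divr_gt0.
    by rewrite ler_sqr ?nnegrE ?normc_ge0 ?Num.Theory.sqrtr_ge0.
  have -> (c : R) : \sum_(x <- A) c = #|` A|%:R * c.
    by rewrite big_const_seq count_predT iter_addr_0 mulr_natl.
  rewrite mulrA ler_pdivrMr// mulrC.
  rewrite ler_wpM2l ?(ltW e2)// /N ler_wpDr// ler_nat.
  exact: fsubset_leq_card.
rewrite (splitr (e ^+ 2)) EFinD; apply: lee_ltD => //.
  by rewrite ge0_fin_numE;
    [exact: le_lt_trans Gle (ltry _)|apply: esum_ge0 => x _; rewrite lee_fin].
apply: le_lt_trans Ge; apply: le_esum => x _; rewrite lee_fin; exact: Uw.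
Qed.

(** The coefficient is the inner product of [indic_op S (V (delta y))] with the unit vector
    [V (delta y')], so decay in [y] alone controls the whole matrix. *)
Lemma range_proj_ghost_coef (S : set X) y y' :
  normc (inner (range_proj S (delta y)) (delta y')) <=
  ell2_norm (indic_op S (V (delta y))).
Proof.
rewrite range_projE inner_adjr// -/V; apply: le_trans (cauchy_schwarz _ _) _.
by rewrite (norm_unitary uV) norm_delta mulr1.
Qed.

Lemma range_proj_ghost (C : set (set (Y * Y))) (S : set X) (w : X -> R) :
  uniform_roe C (range_proj S) ->
  (forall x y, normc (U (delta x) y : R[i]) ^+ 2 <= w x) ->
  (\esum_(x in S) (w x)%:E < +oo)%E -> ghost C (range_proj S).
Proof.
move=> CS Uw wS; split=> // e e0; have [F FP] := range_proj_vanish Uw wS e0.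
exists [set` F] => // y y' yF _; apply: le_lt_trans (range_proj_ghost_coef _ _ _) _.
by apply: FP; exact/negP.
Qed.

(** The sum over [A] is the projection for the union of the blocks with index in [A]; once [A]
    contains the image of [G] under [f], this union contains [G]. *)
Lemma range_proj_sum (f : X -> nat) (u : ell2 R Y) :
  partial_sum ((fun n => range_proj [set x | f x = n])^~ u) @ totally --> u.
Proof.
apply/cvg_totallyP => e e0; have [G GP] := finite_approx (V u) e0.
exists [fset f x | x in G]%fset => A GA.
rewrite partial_sumE (_ : \sum_(n <- A) _ = U (indic_op [set x | f x \in A] (V u))).
  rewrite -{1}(unitaryK uU u) -(linear_sub _ _ bU.1) normr_ell2E norm_unitary//.
  rewrite ltcR; apply: GP => x /= xG; apply: (fsubsetP GA); apply/imfsetP.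
  by exists x.
under eq_bigr do rewrite range_projE.
rewrite -(linear_bigsum _ _ _ bU.1); congr U; apply: ell2P => x.
rewrite ell2_sumE indic_opE.
rewrite (eq_bigr (fun n => if n == f x then V u x : R[i] else 0)); last first.
  move=> n _; rewrite indic_opE; case: (eqVneq n (f x)) => [->|nf].
    by rewrite mem_set.
  by rewrite memNset//= => fn; rewrite fn eqxx in nf.
have [fA|fA] := boolP (f x \in A).
  rewrite mem_set// (big_fsetD1 (f x))//= eqxx big_seq big1 ?addr0// => n.
  by rewrite !inE => /andP[/negPf ->].
rewrite memNset; last exact/negP.
rewrite big_seq big1// => n nA; case: eqP => // nf.
by rewrite -nf nA in fA.
Qed.

(** * A sequence of columns with summable bounds, and the partition it yields *)

Let spread e := exists x, forall y, normc (U (delta x) y : R[i]) < e.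

Lemma spread_sequence : (forall e : R, 0 < e -> spread e) ->
  exists2 a : nat -> X, injective a &
    forall n y, normc (U (delta (a n)) y : R[i]) ^+ 2 <= (1 / (2 ^ n.+1)%:R).
Proof.
move=> sp.
(* One coefficient of [U (delta x)] exceeds in modulus all those of [U (delta x')]: a strict order
   that involves no supremum and makes the sequence injective. *)
pose lt x' x := exists y0, forall y,
  normc (U (delta x') y : R[i]) < normc (U (delta x) y0 : R[i]).
have lt_trans x y z : lt x y -> lt y z -> lt x z.
  move=> [y0 h0] [y1 h1]; exists y1 => y2;
    exact: Order.POrderTheory.lt_trans (h0 _) (h1 _).
have ltxx x : ~ lt x x by move=> [y0 /(_ y0)]; rewrite ltxx.
have pos (n : nat) : 0 < 1 / (2 ^ n.+1)%:R :> R by rewrite divr_gt0// ltr0n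
  expn_gt0.
have step (p : X * nat) : exists x', lt x' p.1 /\
    forall y, normc (U (delta x') y : R[i]) ^+ 2 <= 1 / (2 ^ p.2.+1)%:R.
  have [y0 y0P] : exists y, U (delta p.1) y != 0 :> R[i].
    apply: contrapT => none.
    have : ell2_norm (U (delta p.1)) = 1 by rewrite norm_unitary// norm_delta.
    rewrite (_ : U _ = 0) ?ell2_norm0; first by move/eqP; rewrite eq_sym oner_eq0.
    apply: ell2P => y; apply/eqP; apply: contrapT => /negP yP; apply: none.
    by exists y.
  (* Below the first number the new point is [lt] the old one; the second is the bound wanted at
     index [p.2]. *)
  have m0 : 0 < Num.min (normc (U (delta p.1) y0 : R[i])) (1 / (2 ^ p.2.+1)%:R).
    by rewrite lt_min pos normc_gt0 y0P.
  have [x' x'P] := sp _ m0.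
  exists x'; split; first by exists y0 => y; have := x'P y;
    rewrite lt_min => /andP[].
  move=> y; have := x'P y; rewrite lt_min => /andP[_ /ltW h].
  (* A coefficient of a unit vector has modulus at most 1, so its square is no larger. *)
  apply: le_trans h; rewrite expr2 ler_piMl ?normc_ge0//.
  by apply: le_trans (normc_le_norm _ _) _; rewrite norm_unitary// norm_delta.
have {step} /choice[s sP] := step.
have [x0 _] := sp 1 ltr01.
pose a := nat_rect (fun=> X) (s (x0, 0%N)) (fun n x => s (x, n.+1)).
have aS n : lt (a n.+1) (a n) by exact: (sP (a n, n.+1)).1.
have alt i j : (i < j)%N -> lt (a j) (a i).
  elim: j => // j IHj; rewrite ltnS leq_eqVlt => /orP[/eqP ->//|/IHj];
    exact: lt_trans.
exists a => [i j aij|[|n] y].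
- case: (ltngtP i j) => // /alt; rewrite aij => /ltxx//.
- exact: (sP (x0, 0%N)).2.
- exact: (sP (a n, n.+1)).2.
Qed.

Lemma spread_partition : countable [set: X] -> (forall e : R, 0 < e -> spread e) ->
  exists (f : X -> nat) (w : X -> R),
  [/\ forall x y, normc (U (delta x) y : R[i]) ^+ 2 <= w x,
      forall n, (\esum_(x in [set x | f x = n]) (w x)%:E < +oo)%E &
      forall n, exists2 b : nat -> X, injective b & forall k, f (b k) = n].
Proof.
move=> /pcard_injP[g ginj] /spread_sequence[a ainj aP].
pose r x := if pselect (exists k, a k = x) is left e then Some (projT1 (cid e))
  else None.
have ra k : r (a k) = Some k.
  rewrite /r; case: pselect => [e|[]]; last by exists k.
  by case: cid => j /= /ainj ->.
have rS x k : r x = Some k -> a k = x.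
  by rewrite /r; case: pselect => [e|//]; case: cid => j /= <- [->].
(* Decoding [k] as a pair and keeping the first component takes every value infinitely often; a [k]
   that codes no pair goes to class 0. Off the sequence, the injective [g] puts at most one point
   into each class. *)
pose f x := if r x is Some k then (odflt (0%N, 0%N) (choice.unpickle k)).1 else g x.
pose w x : R := if r x is Some k then 1 / (2 ^ k.+1)%:R else 1.
have w0 x : 0 <= w x by rewrite /w; case: (r x) => // k; rewrite divr_ge0.
exists f, w; split.
- move=> x y; rewrite /w; case rx : (r x) => [k|]; first by rewrite -(rS _ _ rx).
  rewrite expr_le1 ?normc_ge0//; apply: le_trans (normc_le_norm _ _) _.
  by rewrite norm_unitary// norm_delta.
- move=> n; rewrite (esumID (range a)); last by move=> x _; rewrite lee_fin.
  apply: lte_add_pinfty.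
    apply: (@le_lt_trans _ _ (\esum_(x in range a) (w x)%:E)%E).
      rewrite [leLHS]esum_mkcond [leRHS]esum_mkcond; apply: le_esum => x _.
      rewrite in_setI; case: (x \in range a); rewrite ?andbF//.
      by case: ifP => //; rewrite lee_fin.
    rewrite esum_image; last by move=> i j _ _ /ainj.
    rewrite -nneseries_esumT => [|k]; last by rewrite lee_fin.
    rewrite (eq_eseriesr (g := fun k => (1 / (2 ^ k.+1)%:R)%:E)); last first.
      by move=> k _; rewrite /w ra.
    (* The bounds 1 / 2^(k+1) have sum at most 1. *)
    by apply: le_lt_trans (epsilon_trick0 xpredT ler01) _; exact: ltry.
  have none x : ~ range a x -> r x = None.
    by move=> nx; case rx : (r x) => [k|//]; case: nx; exists k => //; exact: rS.
  have [[z [zn za]]|nz] := pselect (exists z, f z = n /\ ~ range a z); last first.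
    by rewrite esum1 ?ltry// => x [xn xa]; case: nz; exists x.
  apply: (@le_lt_trans _ _ (\esum_(x in [set z]) (w x)%:E)%E).
    rewrite [leLHS]esum_mkcond [leRHS]esum_mkcond; apply: le_esum => x _.
    case: ifPn => [|_]; last by case: ifP => //; rewrite lee_fin.
    rewrite inE => -[/= xn xa]; rewrite mem_set//=; apply: ginj; rewrite ?inE//.
    by move: xn zn; rewrite /f (none _ xa) (none _ za) => -> ->.
  by rewrite esum_set1 ?lee_fin// ltry.
- move=> n; exists (fun k => a (choice.pickle (n, k))) => [i j /ainj|k].
    by move/(pcan_inj choice.pickleK) => [].
  by rewrite /f ra choice.pickleK.
Qed.

Lemma ghost_partition (C : set (set (Y * Y))) (B : set (op R Y)) :
  countable [set: X] -> (forall e : R, 0 < e -> spread e) ->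
  B `<=` uniform_roe C -> (forall S, B (range_proj S)) ->
  exists (J : choiceType) (Q : J -> op R Y),
  [/\ forall j, [/\ B (Q j), projection_op (Q j), ghost C (Q j) &
                    ~ compact_op (Q j)],
      forall i j, i <> j -> Q i \o Q j = 0 &
      forall u, partial_sum (Q^~ u) @ totally --> u].
Proof.
move=> cX sp BC BP; have [f [w [Uw wf fb]]] := spread_partition cX sp.
exists nat, (fun n => range_proj [set x | f x = n]); split.
- move=> n; split=> //; first exact: projection_range_proj.
    by apply: range_proj_ghost (Uw) (wf n) => //; exact: BC.
  by have [b binj bP] := fb n; exact: range_proj_noncompact binj bP.
- move=> i j ij; apply: range_proj_orthogonal.
  by apply/seteqP; split=> // x [/= fi fj]; apply: ij; rewrite -fi -fj.
- exact: range_proj_sum.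
Qed.

End ghost_projections.

(** * Nonrigid isomorphisms *)

Section metrizable_coarse_spaces.
Context {R : realType} {X : choiceType} (C : set (set (X * X))).
Hypotheses (cC : coarse_structure C) (mC : metrizable R C).

(** The metric takes finite values, so the pair lies in the entourage of radius [d x y]. This
    provides the rank one operators between basis vectors. *)
Lemma metrizable_point x y : C [set (x, y)].
Proof.
have [d dm CE] := mC; have [_ Cs _ _ _] := cC; have [d0 _ _ _] := dm.
apply: (Cs [set p | d p.1 p.2 <= d x y]); last by move=> _ -> /=.
by rewrite CE; apply: sub_gen_smallest; exists (d x y) => //=.
Qed.

(** Balls of integer radius around one point exhaust [X], and uniform local finiteness makes them
    finite. *)
Lemma metrizable_countable : uniformly_locally_finite C -> countable [set: X].
Proof.
move=> ulf; have [d dm CE] := mC; have [d0 _ _ _] := dm.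
have [[x0 _]|nx] := pselect (exists x : X, True); last first.
  suff -> : [set: X] = set0 by exact: countable0.
  by apply/seteqP; split=> // x _; case: nx; exists x.
have -> : [set: X] = \bigcup_(n in [set: nat]) [set y | d x0 y <= n%:R].
  apply/seteqP; split=> // y _; exists (Num.trunc (d x0 y)).+1 => //=.
  by rewrite ltW// truncnS_gt.
apply: bigcup_countable => // n _; apply: finite_set_countable.
have /ulf[m /(_ x0) mP] : C [set p | d p.1 p.2 <= n%:R].
  by rewrite CE; apply: sub_gen_smallest; exists n%:R => //=.
by apply: sub_finite_set (card_le_finite mP (finite_II m)).
Qed.

End metrizable_coarse_spaces.

Section ghostly.
Context {R : realType} {X Y : choiceType}.

Lemma not_bounded_below_spread (W : ell2 R X -> ell2 R Y) :
  ~ (0 < ereal_inf [set ereal_sup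
         [set (normc (inner (W (delta x)) (delta y)))%:E | y in [set: Y]]
         | x in [set: X]])%E ->
  forall e : R, 0 < e -> exists x, forall y, normc (W (delta x) y : R[i]) < e.
Proof.
move=> /negP; rewrite -leNgt => inf0 e e0.
have /ereal_inf_lt[_ [x _ <-] lt] := le_lt_trans inf0 (e0 : (0%:E < e%:E)%E).
exists x => y; rewrite -lte_fin; apply: le_lt_trans lt.
by apply: ereal_sup_ubound; exists y => //; rewrite inner_delta.
Qed.

(** Stated for any unitary, to be applied to [U] for one alternative and, with the spaces exchanged,
    to [adj U] for the other. *)
Lemma ghostly_conjugate (U : ell2 R X -> ell2 R Y)
    (E : set (set (X * X))) (F : set (set (Y * Y))) :
  unitary_op U -> coarse_structure E -> metrizable R E ->
  uniformly_locally_finite E ->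
  uniform_roe F = conj_op U @^-1` uniform_roe E ->
  ~ (0 < ereal_inf [set ereal_sup
         [set (normc (inner (U (delta x)) (delta y)))%:E | y in [set: Y]]
         | x in [set: X]])%E ->
  ghostly_cartan_masa F (conj_op U @^-1` ell_infty).
Proof.
move=> uU cE mE ulfE FE /not_bounded_below_spread sp; split.
  rewrite FE.
  exact: (conj_op_preimage_cartan uU (uniform_roe_cstar cE) id_ell_infty
    (ell_infty_cartan cE ulfE)).
apply: (ghost_partition uU (metrizable_countable mE ulfE) sp) => [|S].
  by rewrite FE => S; exact: ell_infty_roe.
by rewrite /preimage/= /range_proj conj_opVK//; exact: indic_ell_infty.
Qed.

End ghostly.

Lemma ell2_empty (R : realType) (X : choiceType) (u v : ell2 R X) :
  ~ (exists x : X, True) -> u = v.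
Proof. by move=> nX; apply: ell2P => x; case: nX; exists x. Qed.

(** This covers the case without a base point for [spatial_implementation]. There is a single
    operator on [ell2 R X], so surjectivity of [Phi] identifies 0 and the identity on [ell2 R Y],
    and [Y] is empty too; the zero map is then unitary, and both infima are taken over the empty
    set. *)
Lemma rigidly_implemented_empty (R : realType) (X Y : choiceType)
    (E : set (set (X * X))) (F : set (set (Y * Y))) (Phi : op R X -> op R Y) :
  coarse_structure F -> star_isomorphism (uniform_roe E) (uniform_roe F) Phi ->
  ~ (exists x : X, True) -> rigidly_implemented E Phi.
Proof.
move=> cF [[_ _ surj] _ _ _] nX.
have nY : ~ (exists y : Y, True).
  move=> [y _]; have [[[_ F0] _ _ _] _] := @uniform_roe_cstar R _ _ cF.
  have [a _ a0] := surj _ F0.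
  have [b _ b1] := surj _ (ell_infty_roe cF id_ell_infty).
  have ab : a = b by apply/funext => u; exact: ell2_empty.
  have : ell2_norm (delta y : ell2 R Y) = 0.
    by rewrite -[delta y]/(id (delta y)) -b1 -ab a0 ell2_norm0.
  by move/eqP; rewrite norm_delta oner_eq0.
exists 0; split.
- split; first exact: bounded_op0.
  + by apply/funext => u; exact: ell2_empty.
  + by apply/funext => u; exact: ell2_empty.
- by move=> T _; apply/funext => u; exact: ell2_empty.
- rewrite (_ : [set: X] = set0) ?image_set0 ?ereal_inf0 ?ltry//.
  by apply/seteqP; split=> // x _; case: nX; exists x.
- rewrite (_ : [set: Y] = set0) ?image_set0 ?ereal_inf0 ?ltry//.
  by apply/seteqP; split=> // y _; case: nY; exists y.
Qed.

Theorem theorem6p1 (R : realType) (X Y : choiceType)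
    (E : set (set (X * X))) (F : set (set (Y * Y)))
    (cE : coarse_structure E) (cF : coarse_structure F)
    (mE : metrizable R E) (mF : metrizable R F)
    (ulfE : uniformly_locally_finite E) (ulfF : uniformly_locally_finite F)
    (Phi : op R X -> op R Y)
    (isoPhi : star_isomorphism (uniform_roe E) (uniform_roe F) Phi)
    (nrPhi : ~ rigidly_implemented E Phi) :
  ghostly_cartan_masa F (Phi @` ell_infty) \/
  ghostly_cartan_masa E (uniform_roe E `&` Phi @^-1` ell_infty).
Proof.
have [[x0 _]|nX] := pselect (exists x : X, True); last first.
  by case: nrPhi; exact: rigidly_implemented_empty isoPhi nX.
have cA := @uniform_roe_cstar R _ _ cE; have cB := @uniform_roe_cstar R _ _ cF.
have [U uU PhiE] := spatial_implementation cA cB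
  (fun x y => rank1_delta_roe (metrizable_point cE mE y x) cE)
  (fun x y => rank1_delta_roe (metrizable_point cF mF y x) cF) isoPhi x0.
have uV := unitary_adj uU.
have bU := unitary_bounded uU.
have PhiV T : uniform_roe E T -> Phi T = conj_op (adj U) T.
  by move=> ET; rewrite PhiE// conj_op_adjE.
have cdE T : conj_op U (conj_op (adj U) T) = T := conj_opVK uU T.
have dcE S : conj_op (adj U) (conj_op U S) = S := conj_opK uU S.
have [[Phi_mem _ Phi_surj] _ _ _] := isoPhi.
have roeE : uniform_roe F = conj_op U @^-1` uniform_roe E :> set (op R Y).
  apply/seteqP; split=> [S /Phi_surj[T ET <-]|S ES].
    by rewrite (PhiV _ ET) /preimage/= cdE.
  by rewrite -(dcE S) -(PhiV _ ES); exact: Phi_mem.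
have roeF : uniform_roe E = conj_op (adj U) @^-1` uniform_roe F :> set (op R X).
  by apply/seteqP; split=> T; rewrite roeE /preimage/= cdE.
(* If the first bound fails, [U] gives (i); otherwise the second fails, or [U] would witness
   rigidity, and [adj U] gives (ii). *)
have [inf0|inf_gt0] := pselect (~ (0 < ereal_inf [set ereal_sup
    [set (normc (inner (U (delta x)) (delta y)))%:E | y in [set: Y]]
    | x in [set: X]])%E).
  left; rewrite (_ : Phi @` _ = conj_op U @^-1` ell_infty).
    exact: (ghostly_conjugate uU cE mE ulfE roeE inf0).
  apply/seteqP; split=> [_ [T iT <-]|S iS].
    by rewrite (PhiV _ (ell_infty_roe cE iT)) /preimage/= cdE.
  by exists (conj_op U S) => //; rewrite (PhiV _ (ell_infty_roe cE iS)) dcE.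
right; rewrite (_ : _ `&` _ = conj_op (adj U) @^-1` ell_infty).
  apply: (ghostly_conjugate uV cF mF ulfF roeF) => inf_gt0'.
  by apply: nrPhi; exists U; split=> //; exact: contrapT.
(* [Phi] agrees with Ad U only on [uniform_roe E], hence the intersection; [roeF] places there every
   operator that Ad U sends into [ell_infty]. *)
apply/seteqP; split=> [T [ET iT]|T iT].
  by rewrite /preimage/= -(PhiV _ ET).
have ET : uniform_roe E T by rewrite roeF; exact: (ell_infty_roe cF iT).
by split=> //; rewrite /preimage/= (PhiV _ ET).
Qed.
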